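(* Let $\mathfrak g\subset\mathfrak{gl}(V)$ be any of the maximal split algebras (1)–(10) listed in the context, with its representation $V$ regarded as a real vector space. Then $$\partial\left(V^*\otimes_{\mathbb R}\mathfrak g^{(1)}\right)\;\cong\; R(\mathfrak g),$$ the isomorphism being given by the Ricci trace.
   Context: All tensor, exterior and symmetric powers are over $\mathbb R$. For $\mathfrak g\subset\mathfrak{gl}(V)=V^*\otimes V$: - $\mathfrak g^{(1)}=(\mathfrak g\otimes V^* )\cap(V\otimes\odot^2V^* )$. - $\partial$ denotes antisymmetrisation. On $V^*\otimes\mathfrak g^{(1)}$ it antisymmetrises the factor $V^*$ with the $V^*$ factor of $\mathfrak g^{(1)}\subset V^*\otimes\mathfrak g$, and takes values in $\wedge^2V^*\otimes\mathfrak g$. On $\wedge^2V^*\otimes\mathfrak g\subset \wedge^2V^*\otimes V^*\otimes V$ it antisymmetrises over the three $V^*$ components, and takes values in $\wedge^3V^*\otimes V$. - $K(\mathfrak g)=\ker\big(\partial:\wedge^2V^*\otimes\mathfrak g\to\wedge^3V^*\otimes V\big)$ is the formal curvature module; it contains $\partial(V^*\otimes\mathfrak g^{(1)})$. - The Ricci trace sends $k\in K(\mathfrak g)$ to $\mathsf{Ric}(k)\in V^*\otimes V^*$, $\mathsf{Ric}(k)(x,y)=\mathrm{tr}\big(z\mapsto k(x,z)y\big)$, and $R(\mathfrak g)$ is the image of $K(\mathfrak g)$ under it. For $\mathbb F=\mathbb C,\mathbb H$, $H_n^+(\mathbb F)$ (resp. $H_n^-(\mathbb F)$) is the space of self-adjoint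 (resp. skew-adjoint) $n\times n$ matrices over $\mathbb F$. The maximal split algebras are the following (in each case $\mathfrak g$ means the image of the named algebra in $\mathfrak{gl}(V)$ under its natural representation; scalar summands act by scalar multiplication, and $\mathfrak{gl}(n,\mathbb F)$ acts on $H_n^\pm(\mathbb F)$ by $S\mapsto AS+SA^*$): 1. $\mathfrak{gl}(n,\mathbb R)$ on $\odot^2\mathbb R^n$, $n\ge3$; 2. $\mathfrak{gl}(n,\mathbb R)$ on $\wedge^2\mathbb R^n$, $n\ge5$; 3. $\mathfrak{gl}(n,\mathbb C)$ on $\odot^2_{\mathbb C}\mathbb C^n$, $n\ge3$; 4. $\mathfrak{gl}(n,\mathbb C)$ on $\wedge^2_{\mathbb C}\mathbb C^n$, $n\ge5$; 5. $\mathfrak{gl}(n,\mathbb C)$ on $H_n^+(\mathbb C)$, $n\ge3$; 6. $\mathfrak{gl}(n,\mathbb H)$ on $H_n^+(\mathbb H)$, $n\ge3$; 7. $\mathfrak{gl}(n,\mathbb H)$ on $H_n^-(\mathbb H)$, $n\ge2$; 8. $\mathbb C\oplus\mathfrak{sl}(m,\mathbb C)\oplus\mathfrak{sl}(r,\mathbb C)$ on $\mathbb C^m\otimes_{\mathbb C}\mathbb C^r$, $m>r\ge2$ or $m\ge r>2$; 9. $\mathbb R\oplus\mathfrak{sl}(m,\mathbb R)\oplus\mathfrak{sl}(r,\mathbb R)$ on $\mathbb R^m\otimes\mathbb R^r$, $m>r\ge2$ or $m\ge r>2$; 10. $\mathbb R\oplus\mathfrak{sl}(m,\mathbb H)\oplus\mathfrak{sl}(r,\mathbb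 H)$ on $\mathbb H^m\otimes_{\mathbb H}\mathbb H^r\cong\mathbb R^{4mr}$, $m>r\ge1$ or $m\ge r>1$. *)

(* Defs.v *)
From HB Require Import structures.
From mathcomp Require Import all_boot all_order all_algebra all_field.
From mathcomp Require Import classical_sets functions reals.
From mathcomp Require Import complex ring.

Set Implicit Arguments.
Unset Strict Implicit.
Unset Printing Implicit Defensive.

Import Order.TTheory GRing.Theory Num.Theory.

Local Open Scope classical_set_scope.
Local Open Scope ring_scope.

(* Tensors are linear maps: V* (x) E is 'Hom(V, E), so gl(V) is 'End(V),
   V* (x) V* is 'Hom(V, 'Hom(V, R^o)) and V* (x) V* (x) gl(V) is
   'Hom(V, 'Hom(V, 'End(V))). If g is a subspace of E, V* (x) g is the set of
   linear maps V -> E with values in g. *)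
Section Curvature.
Variables (R : fieldType) (V : vectType R).

Definition tens2 (E : vectType R) := 'Hom(V, 'Hom(V, E)).

Definition ev2 (E : vectType R) (k : tens2 E) (x y : V) : E :=
  (k x : 'Hom(V, E)) y.

Section Bilinear.
Variables (E : vectType R) (b : V -> V -> E).
Hypotheses (bl : forall y, linear (b^~ y)) (br : forall x, linear (b x)).

Lemma bilin_homE x y :
  ev2 (linfun (fun x => linfun (b x)) : tens2 E) x y = b x y.
Proof.
have inE u v : linfun (b u) v = b u v.
  pose m := GRing.isLinear.Build _ _ _ _ (b u) (br u).
  pose f : {linear V -> E} := HB.pack (b u) m.
  exact: (lfunE f).
have outL : linear (fun u => linfun (b u)).
  move=> a u v; apply/lfunP => w.
  by rewrite !(add_lfunE, scale_lfunE) !inE bl.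
pose m := GRing.isLinear.Build _ _ _ _ (fun u => linfun (b u)) outL.
pose f : {linear V -> 'Hom(V, E)} := HB.pack (fun u => linfun (b u)) m.
by rewrite /ev2 (lfunE f) /= inE.
Qed.

End Bilinear.

Lemma ev2_linl (E : vectType R) (k : tens2 E) y : linear ((ev2 k)^~ y).
Proof. by move=> a u v; rewrite /ev2 linearP add_lfunE scale_lfunE. Qed.

Lemma ev2_linr (E : vectType R) (k : tens2 E) x : linear (ev2 k x).
Proof. by move=> a u v; rewrite /ev2 linearP. Qed.

Lemma ev2P (E : vectType R) (k l : tens2 E) :
  (forall x y, ev2 k x y = ev2 l x y) <-> k = l.
Proof.
by split=> [kl|-> //]; apply/lfunP => x; apply/lfunP => y; exact: kl.
Qed.

Lemma ev2D (E : vectType R) a (k l : tens2 E) x y :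
  ev2 (a *: k + l) x y = a *: ev2 k x y + ev2 l x y.
Proof. by rewrite /ev2 !(add_lfunE, scale_lfunE). Qed.

Definition transp (E : vectType R) (k : tens2 E) : tens2 E :=
  linfun (fun x => linfun (fun y => ev2 k y x)).

Lemma transpE (E : vectType R) (k : tens2 E) x y :
  ev2 (transp k) x y = ev2 k y x.
Proof.
by rewrite /transp bilin_homE // => z; [exact: ev2_linr|exact: ev2_linl].
Qed.

Definition lftrace (f : 'End(V)) : R :=
  \tr (passmx.mxof (vbasis fullv) (vbasis fullv) f).

Lemma lftrace_is_scalar : scalar lftrace.
Proof.
by move=> a f h; rewrite /lftrace passmx.mxof_linear mxtraceD mxtraceZ.
Qed.

HB.instance Definition _ :=
  GRing.isLinear.Build R 'End(V) R _ lftrace lftrace_is_scalar.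

(* The first prolongation g^(1): the intersection of V* (x) g with
   Sym^2 V* (x) V. *)
Definition prolong (g : set 'End(V)) : set 'Hom(V, 'End(V)) :=
  [set phi | (forall x, g (phi x)) /\
             (forall x y, (phi x : 'End(V)) y = (phi y : 'End(V)) x)].

Definition antisym2 (psi : tens2 'End(V)) : tens2 'End(V) := psi - transp psi.

Lemma antisym2E psi x y : ev2 (antisym2 psi) x y = ev2 psi x y - ev2 psi y x.
Proof.
by rewrite -[ev2 psi y x]transpE /ev2 !(add_lfunE, opp_lfunE).
Qed.

Definition im_antisym2 (g : set 'End(V)) : set (tens2 'End(V)) :=
  antisym2 @` [set psi : tens2 'End(V) | forall x, prolong g (psi x)].

Definition alt2 (g : set 'End(V)) : set (tens2 'End(V)) :=
  [set k | (forall x y, g (ev2 k x y)) /\ (forall x, ev2 k x x = 0)].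

(* If k is already alternating in x and y, the signed sum over the six
   permutations of (x, y, z) is twice this cyclic sum. *)
Definition antisym3 (k : tens2 'End(V)) (x y z : V) : V :=
  ev2 k x y z + ev2 k y z x + ev2 k z x y.

Definition curv (g : set 'End(V)) : set (tens2 'End(V)) :=
  [set k | alt2 g k /\ forall x y z, antisym3 k x y z = 0].

Definition ric (k : tens2 'End(V)) : tens2 R^o :=
  linfun (fun x => linfun (fun y =>
    lftrace (linfun (fun z => ev2 k x z y)) : R^o)).

Lemma ricE k x y : ev2 (ric k) x y = lftrace (linfun (fun z => ev2 k x z y)).
Proof.
have inL u v : linear (fun z => ev2 k u z v).
  by move=> a z w; rewrite ev2_linr add_lfunE scale_lfunE.
have inE u v z : linfun (fun z => ev2 k u z v) z = ev2 k u z v.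
  pose m := GRing.isLinear.Build _ _ _ _ _ (inL u v).
  pose f : {linear V -> V} := HB.pack (fun z => ev2 k u z v) m.
  exact: (lfunE f).
rewrite /ric bilin_homE // => {x y} [y|x] a u v /=.
  rewrite -[RHS]linearP; congr lftrace; apply/lfunP => z.
  by rewrite add_lfunE scale_lfunE !inE ev2_linl add_lfunE scale_lfunE.
rewrite -[RHS]linearP; congr lftrace; apply/lfunP => z.
by rewrite add_lfunE scale_lfunE !inE linearP.
Qed.

Lemma ric_is_linear : linear ric.
Proof.
move=> a k l; apply/ev2P => x y; rewrite ev2D !ricE -[RHS]linearP.
congr lftrace.
have inE (j : tens2 'End(V)) z : linfun (fun z => ev2 j x z y) z = ev2 j x z y.
  have inL : linear (fun z => ev2 j x z y).
    by move=> b u v; rewrite ev2_linr add_lfunE scale_lfunE.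
  pose m := GRing.isLinear.Build _ _ _ _ _ inL.
  pose f : {linear V -> V} := HB.pack (fun z => ev2 j x z y) m.
  exact: (lfunE f).
apply/lfunP => z.
by rewrite add_lfunE scale_lfunE !inE ev2D add_lfunE scale_lfunE.
Qed.

HB.instance Definition _ :=
  GRing.isLinear.Build R (tens2 'End(V)) (tens2 R^o) _ ric ric_is_linear.

Definition ric_space (g : set 'End(V)) : set (tens2 R^o) := ric @` curv g.

End Curvature.

(* Matrices over a finite-dimensional real algebra F, as a real vector space;
   'M[F]_(m, n) itself is only a module over F. *)
Definition resmx (R : fieldType) (F : vectType R) m n := 'M[F]_(m, n).

Section RealMatrices.
Import VectorInternalTheory.
Variables (R : fieldType) (F : vectType R) (m n : nat).
Local Notation M := (resmx F m n).

HB.instance Definition _ := GRing.Zmodule.copy M 'M[F]_(m, n).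

Definition resmx_scale (a : R) (A : M) : M := map_mx ( *:%R a) A.

Fact resmx_scaleA a b A :
  resmx_scale a (resmx_scale b A) = resmx_scale (a * b) A.
Proof. by apply/matrixP => i j; rewrite !mxE scalerA. Qed.
Fact resmx_scale1 : left_id 1 resmx_scale.
Proof. by move=> A; apply/matrixP => i j; rewrite !mxE scale1r. Qed.
Fact resmx_scaleDr : right_distributive resmx_scale +%R.
Proof. by move=> a A B; apply/matrixP => i j; rewrite !mxE scalerDr. Qed.
Fact resmx_scaleDl A : {morph resmx_scale^~ A : a b / a + b}.
Proof. by move=> a b; apply/matrixP => i j; rewrite !mxE scalerDl. Qed.

HB.instance Definition _ := GRing.Zmodule_isLmodule.Build R M
  resmx_scaleA resmx_scale1 resmx_scaleDr resmx_scaleDl.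

Lemma resmx_scaleE a (A : M) i j : (a *: A) i j = a *: A i j.
Proof. by rewrite mxE. Qed.

Fact resmx_vect_iso :
  Vector.axiom (dim {ffun 'I_m * 'I_n -> F}) M.
Proof.
pose h (A : M) : {ffun 'I_m * 'I_n -> F} := [ffun ij => A ij.1 ij.2].
exists (v2r \o h).
  move=> a A B /=; have -> : h (a *: A + B) = a *: h A + h B.
    by apply/ffunP => ij; rewrite !ffunE !mxE.
  by rewrite linearD linearZ.
apply: bij_comp; first by exists r2v; [exact: v2rK|exact: r2vK].
exists (fun f : {ffun 'I_m * 'I_n -> F} => \matrix_(i, j) f (i, j)) => [A|f].
  by apply/matrixP => i j; rewrite !mxE ffunE.
by apply/ffunP => -[i j]; rewrite ffunE mxE.
Qed.

HB.instance Definition _ := Lmodule_hasFinDim.Build R M resmx_vect_iso.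

End RealMatrices.

Definition adjmx (F : Type) (sigma : F -> F) m n (A : 'M[F]_(m, n)) :
  'M[F]_(n, m) := (map_mx sigma A)^T.

Section SplitAlgebras.
Variables (R : fieldType) (F : falgType R).

(* herm sigma e n is {S | S^* = e S}. With sigma the identity and e = 1 or -1
   it models Sym^2 F^n or Alt^2 F^n (for commutative F) by symmetric or
   antisymmetric matrices: the product of column vectors v and w is
   v w^T + e w v^T, so that A acts by S |-> A S + S A^T. *)
Section Hermitian.
Variables (sigma : {linear F -> F}) (e : R) (n : nat).

Definition herm_eq (S : resmx F n n) : resmx F n n := adjmx sigma S - e *: S.

Lemma herm_eq_is_linear : linear herm_eq.
Proof.
move=> a S T; apply/matrixP => i j; rewrite !mxE linearP.
by rewrite !scalerDr scalerN !scalerA opprD addrACA [a * e]mulrC.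
Qed.

HB.instance Definition _ := GRing.isLinear.Build R
  (resmx F n n) (resmx F n n) _ herm_eq herm_eq_is_linear.

Definition herm : {vspace resmx F n n} := lker (linfun herm_eq).

Lemma mem_herm (S : resmx F n n) :
  (S \in herm) = (adjmx sigma S == e *: S :> resmx F n n).
Proof. by rewrite memv_ker lfunE /= /herm_eq subr_eq0. Qed.

(* the image of gl(n, F), acting by S |-> A S + S A^* *)
Definition gl_herm : set 'End(subvs_of herm) :=
  [set f : 'End(subvs_of herm) |
     exists A : 'M[F]_n, forall S : subvs_of herm,
       vsval (f S) = A *m vsval S + vsval S *m adjmx sigma A :> 'M[F]_n].

End Hermitian.

(* F^m (x)_F F^r as the space of m x r matrices, with v (x) w corresponding to
   v w^*; the factors of gl(m, F) and gl(r, F) act by X |-> A X and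
   X |-> X B^*. Here Z is the set of scalars, which are central in F. *)
Definition tensor_alg (sigma : F -> F) m r (Z : set F)
    (sl1 : set 'M[F]_m) (sl2 : set 'M[F]_r) : set 'End(resmx F m r) :=
  [set f : 'End(resmx F m r) | exists c A B, [/\ Z c, sl1 A, sl2 B &
     forall X : resmx F m r,
       f X = c *: (X : 'M[F]_(m, r)) + A *m X + X *m adjmx sigma B
         :> 'M[F]_(m, r)]].

End SplitAlgebras.

(* Rcomplex R is the library's R[i] viewed as an algebra over R. *)
Section Complexes.
Variable R : rcfType.
Local Notation C := (Rcomplex R).

Fact Rcomplex_scaleAr (a : R) (x y : C) : a *: (x * y) = x * (a *: y).
Proof. by rewrite [x * y]mulrC [x * (a *: y)]mulrC scalerAl. Qed.

HB.instance Definition _ := GRing.Lalgebra_isAlgebra.Build R C Rcomplex_scaleAr.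

Fact Rcomplex_vect_iso : Vector.axiom 2 C.
Proof.
exists (fun z : C => \row_(i < 2) [:: complex.Re z; complex.Im z]`_i).
  move=> a [x y] [u v]; apply/rowP => i; rewrite !mxE.
  by case: i => [[|[|?]] ?].
exists (fun v : 'rV[R]_2 => Complex (v 0 0) (v 0 1)) => [[x y]|v].
  by rewrite !mxE.
by apply/rowP => -[[|[|?]] ?] //; rewrite !mxE /=; congr (v 0 _); apply/val_inj.
Qed.

HB.instance Definition _ := Lmodule_hasFinDim.Build R C Rcomplex_vect_iso.

Definition Rconjc (z : C) : C := conjc z.

Fact Rconjc_is_linear : linear Rconjc.
Proof.
by move=> a [x y] [u v]; congr Complex; rewrite /= ?opprD ?mulrN.
Qed.

HB.instance Definition _ :=
  GRing.isLinear.Build R C C _ Rconjc Rconjc_is_linear.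

End Complexes.

Record quat (R : Type) := Quat {qre : R; qi : R; qj : R; qk : R}.

Section Quaternions.
Variable R : fieldType.
Local Notation H := (quat R).

Definition quat_to_prod (x : H) : R * R * R * R := (qre x, qi x, qj x, qk x).
Definition prod_to_quat (p : R * R * R * R) : H :=
  Quat p.1.1.1 p.1.1.2 p.1.2 p.2.
Fact quat_to_prodK : cancel quat_to_prod prod_to_quat.
Proof. by case. Qed.

HB.instance Definition _ := Choice.copy H (can_type quat_to_prodK).

Definition addq (x y : H) : H :=
  Quat (qre x + qre y) (qi x + qi y) (qj x + qj y) (qk x + qk y).
Definition oppq (x : H) : H := Quat (- qre x) (- qi x) (- qj x) (- qk x).

(* i j = k, j k = i, k i = j, i^2 = j^2 = k^2 = -1 *)
Definition mulq (x y : H) : H :=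
  let: Quat a b c d := x in let: Quat a' b' c' d' := y in
  Quat (a * a' - b * b' - c * c' - d * d') (a * b' + b * a' + c * d' - d * c')
       (a * c' - b * d' + c * a' + d * b') (a * d' + b * c' - c * b' + d * a').
Definition scaleq (a : R) (x : H) : H :=
  Quat (a * qre x) (a * qi x) (a * qj x) (a * qk x).
Definition conjq (x : H) : H := Quat (qre x) (- qi x) (- qj x) (- qk x).

Fact addqA : associative addq.
Proof. by move=> x y z; congr Quat; exact: addrA. Qed.
Fact addqC : commutative addq.
Proof. by move=> x y; congr Quat; exact: addrC. Qed.
Fact add0q : left_id (Quat 0 0 0 0) addq.
Proof. by case=> a b c d; congr Quat; exact: add0r. Qed.
Fact addNq : left_inverse (Quat 0 0 0 0) oppq addq.
Proof. by move=> x; congr Quat; exact: addNr. Qed.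

HB.instance Definition _ := GRing.isZmodule.Build H addqA addqC add0q addNq.

Fact mulqA : associative mulq.
Proof. by case=> a b c d [? ? ? ?] [? ? ? ?]; congr Quat => /=; ring. Qed.
Fact mul1q : left_id (Quat 1 0 0 0) mulq.
Proof. by case=> a b c d; congr Quat => /=; ring. Qed.
Fact mulq1 : right_id (Quat 1 0 0 0) mulq.
Proof. by case=> a b c d; congr Quat => /=; ring. Qed.
Fact mulqDl : left_distributive mulq +%R.
Proof. by case=> a b c d [? ? ? ?] [? ? ? ?]; congr Quat => /=; ring. Qed.
Fact mulqDr : right_distributive mulq +%R.
Proof. by case=> a b c d [? ? ? ?] [? ? ? ?]; congr Quat => /=; ring. Qed.
Fact oneq_neq0 : Quat 1 0 0 0 != 0 :> H.
Proof. by apply/eqP => -[] /eqP; rewrite oner_eq0. Qed.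

HB.instance Definition _ := GRing.Zmodule_isNzRing.Build H
  mulqA mul1q mulq1 mulqDl mulqDr oneq_neq0.

Fact scaleqA a b x : scaleq a (scaleq b x) = scaleq (a * b) x.
Proof. by congr Quat; exact: mulrA. Qed.
Fact scaleq1 : left_id 1 scaleq.
Proof. by case=> a b c d; congr Quat; exact: mul1r. Qed.
Fact scaleqDr : right_distributive scaleq +%R.
Proof. by move=> a x y; congr Quat; exact: mulrDr. Qed.
Fact scaleqDl x : {morph scaleq^~ x : a b / a + b}.
Proof. by move=> a b; congr Quat; exact: mulrDl. Qed.

HB.instance Definition _ := GRing.Zmodule_isLmodule.Build R H
  scaleqA scaleq1 scaleqDr scaleqDl.

Fact scaleqAl (a : R) (x y : H) : a *: (x * y) = a *: x * y.
Proof. by case: x y => [? ? ? ?] [? ? ? ?]; congr Quat => /=; ring. Qed.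
Fact scaleqAr (a : R) (x y : H) : a *: (x * y) = x * (a *: y).
Proof. by case: x y => [? ? ? ?] [? ? ? ?]; congr Quat => /=; ring. Qed.

HB.instance Definition _ := GRing.Lmodule_isLalgebra.Build R H scaleqAl.
HB.instance Definition _ := GRing.Lalgebra_isAlgebra.Build R H scaleqAr.

Fact quat_vect_iso : Vector.axiom 4 H.
Proof.
exists (fun x : H => \row_(i < 4) [:: qre x; qi x; qj x; qk x]`_i).
  move=> a x y; apply/rowP => i; rewrite !mxE.
  by case: i => [[|[|[|[|?]]]] ?].
exists (fun v : 'rV[R]_4 => Quat (v 0 (inord 0)) (v 0 (inord 1))
                                 (v 0 (inord 2)) (v 0 (inord 3))) => [[]|v].
  by move=> *; rewrite !mxE !inordK.
by apply/rowP => -[[|[|[|[|?]]]] ?] //; rewrite !mxE /=; congr (v 0 _);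
  apply/val_inj; rewrite /= inordK.
Qed.

HB.instance Definition _ := Lmodule_hasFinDim.Build R H quat_vect_iso.
HB.instance Definition _ := Algebra_isFalgebra.Build R H.

Fact conjq_is_linear : linear conjq.
Proof.
by move=> a [? ? ? ?] [? ? ? ?]; congr Quat; rewrite /= ?opprD ?mulrN.
Qed.

HB.instance Definition _ := GRing.isLinear.Build R H H _ conjq conjq_is_linear.

End Quaternions.

(* For F = R, C this is sl(m, F). *)
Definition sl (F : nzRingType) m : set 'M[F]_m := [set A | \tr A = 0].

(* sl(m, H) is the commutator algebra of gl(m, H), of real codimension 1. *)
Definition slH (R : fieldType) m : set 'M[quat R]_m :=
  [set A | qre (\tr A) = 0].

Inductive maximal_split (R : realType) :
    forall V : vectType R, set 'End(V) -> Prop :=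
| SymR n of (3 <= n)%N :
    maximal_split (@gl_herm R R^o idfun 1 n)
| AltR n of (5 <= n)%N :
    maximal_split (@gl_herm R R^o idfun (-1) n)
| SymC n of (3 <= n)%N :
    maximal_split (@gl_herm R (Rcomplex R) idfun 1 n)
| AltC n of (5 <= n)%N :
    maximal_split (@gl_herm R (Rcomplex R) idfun (-1) n)
| HermC n of (3 <= n)%N :
    maximal_split (@gl_herm R (Rcomplex R) (@Rconjc R) 1 n)
| HermH n of (3 <= n)%N :
    maximal_split (@gl_herm R (quat R) (@conjq R) 1 n)
| SkewH n of (2 <= n)%N :
    maximal_split (@gl_herm R (quat R) (@conjq R) (-1) n)
| TensC m r of (r < m /\ 2 <= r)%N \/ (r <= m /\ 2 < r)%N :
    maximal_split (@tensor_alg R (Rcomplex R) idfun m r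
      setT (@sl (Rcomplex R) m) (@sl (Rcomplex R) r))
| TensR m r of (r < m /\ 2 <= r)%N \/ (r <= m /\ 2 < r)%N :
    maximal_split (@tensor_alg R R^o idfun m r setT (@sl R m) (@sl R r))
| TensH m r of (r < m /\ 1 <= r)%N \/ (r <= m /\ 1 < r)%N :
    maximal_split (@tensor_alg R (quat R) (@conjq R) m r
      (range (fun a : R => a%:A)) (@slH R m) (@slH R r)).

(* Main.v *)
From HB Require Import structures.
Require Import Defs.
From mathcomp Require Import all_boot all_order all_algebra all_field.
From mathcomp Require Import boolp classical_sets functions reals.
From mathcomp Require Import complex ring lra.

Set Implicit Arguments.
Unset Strict Implicit.
Unset Printing Implicit Defensive.

Import Order.TTheory GRing.Theory Num.Theory.

Local Open Scope classical_set_scope.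
Local Open Scope ring_scope.

(* Every V in the list is a space of matrices closed under the triple product
   x p^* y + y p^* x, so that V^* = V embeds in g^(1) by p |-> x p^*, acting on
   V by y |-> x p^* y + y p^* x. For the real inner product Re tr (x^* y) one
   has <z p^*, a> = <z, a p>, which says that the Ricci trace is, up to the
   factor 2, the adjoint of the map d sending q : V -> V to the 2-form
   (x, y) |-> y (q x)^* - x (q y)^*. Hence im d meets ker Ric trivially, and
   the orthogonal projection of a curvature tensor to im d has the same Ricci
   trace.
   It remains that V^* is all of g^(1). If V contains an invertible matrix U,
   an element phi of g^(1) with phi(U)U = 0 vanishes by a Koszul-type argument
   for the form tr (phi(x)y U^-1 z U^-1); for alternating and for rectangular
   matrices the equation phi(x)y = phi(y)x is solved on matrix units. *)

(** * Real inner products *)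

Definition inner_product (R : realFieldType) (V : lmodType R)
    (ip : V -> V -> R) :=
  [/\ forall y, scalar (ip^~ y), forall x y, ip x y = ip y x
    & forall x, x != 0 -> 0 < ip x x].

Section InnerProduct.
Variables (R : realFieldType) (V : lmodType R) (ip : V -> V -> R).
Hypothesis ipP : inner_product ip.

Lemma ipC x y : ip x y = ip y x. Proof. by case: ipP. Qed.

Lemma ipDl x y z : ip (x + y) z = ip x z + ip y z.
Proof. by case: ipP => l _ _; rewrite -[x]scale1r [LHS]l mul1r scale1r. Qed.

Lemma ip0l z : ip 0 z = 0.
Proof. by apply: (addrI (ip 0 z)); rewrite -ipDl !addr0. Qed.

Lemma ipZl a x z : ip (a *: x) z = a * ip x z.
Proof. by case: ipP => l _ _; rewrite -[a *: x]addr0 [LHS]l ip0l addr0. Qed.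

Lemma ipNl x z : ip (- x) z = - ip x z.
Proof. by rewrite -scaleN1r ipZl mulN1r. Qed.

Lemma ipBl x y z : ip (x - y) z = ip x z - ip y z.
Proof. by rewrite ipDl ipNl. Qed.

Lemma ipDr x y z : ip x (y + z) = ip x y + ip x z.
Proof. by rewrite ipC ipDl !(ipC _ x). Qed.

Lemma ipZr a x z : ip x (a *: z) = a * ip x z.
Proof. by rewrite ipC ipZl (ipC _ x). Qed.

Lemma ipNr x z : ip x (- z) = - ip x z.
Proof. by rewrite ipC ipNl ipC. Qed.

Lemma ip_suml (I : Type) (s : seq I) (F : I -> V) z :
  ip (\sum_(i <- s) F i) z = \sum_(i <- s) ip (F i) z.
Proof.
by elim: s => [|i s IHs]; rewrite ?(big_nil, big_cons) ?ip0l // ipDl IHs.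
Qed.

Lemma ip_sumr (I : Type) (s : seq I) (F : I -> V) z :
  ip z (\sum_(i <- s) F i) = \sum_(i <- s) ip z (F i).
Proof. by rewrite ipC ip_suml; apply: eq_bigr => i _; rewrite ipC. Qed.

Lemma ip_ge0 x : 0 <= ip x x.
Proof.
have [->|x0] := eqVneq x 0; first by rewrite ip0l.
by case: ipP => _ _ /(_ x x0)/ltW.
Qed.

Lemma ip_eq0 x : ip x x = 0 -> x = 0.
Proof.
move=> xx; apply/eqP/negP => /negP x0.
by case: ipP => _ _ /(_ x x0); rewrite xx ltxx.
Qed.

Lemma ip_scalar z : scalar (ip z).
Proof. by move=> a x y; rewrite ipDr ipZr. Qed.

End InnerProduct.

Lemma ffun_inner_product (R : realFieldType) (V : vectType R) (I : finType)
    (ip : V -> V -> R) : inner_product ip ->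
  inner_product (fun f g : {ffun I -> V} => \sum_i ip (f i) (g i)).
Proof.
move=> ipP; split=> [g a f h|f g|f fN0].
- rewrite mulr_sumr -big_split /=; apply: eq_bigr => i _.
  by rewrite !ffunE ipDl // ipZl.
- by apply: eq_bigr => i _; rewrite ipC.
- case: (pickP (fun i => f i != 0)) => [i fi|f0]; last first.
    case/eqP: fN0; apply/ffunP => i; rewrite ffunE.
    by apply/eqP; have /negbFE := f0 i.
  rewrite (bigD1 i) //= ltr_wpDr ?sumr_ge0 // => [j _|].
    exact: ip_ge0.
  by case: ipP => _ _; apply.
Qed.

(** * Orthonormal frames, orthogonal projection and traces *)

Section ParsevalFrame.
Variables (R : rcfType) (V : vectType R) (ip : V -> V -> R).
Hypothesis ipP : inner_product ip.

(** Induction on the dimension: normalise one vector of [U] and continue in its orthogonal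
    complement inside [U]. Only the expansion formula is recorded, as projections and traces use
    nothing else. *)
Lemma parseval_frame (U : {vspace V}) : exists s : seq V,
  {in s, forall v, v \in U} /\
  {in U, forall x, x = \sum_(v <- s) ip v x *: v}.
Proof.
have [n] := ubnP (\dim U); elim: n => // n IHn in U * => ltUn.
have [->|UN0] := eqVneq U 0%VS.
  by exists [::]; split=> // x; rewrite memv0 big_nil => /eqP.
have [u uU uu] : exists2 u, u \in U & ip u u = 1.
  pose u := vpick U; have up : 0 < ip u u.
    by case: ipP => _ _; apply; rewrite vpick0.
  exists ((Num.sqrt (ip u u))^-1 *: u); first by rewrite rpredZ // memv_pick.
  rewrite ipZl // ipZr // mulrA -expr2 exprVn sqr_sqrtr ?mulVf ?ltW //.
  by rewrite gt_eqF.
pose m := GRing.isLinear.Build _ _ _ _ (ip u : V -> R^o) (ip_scalar ipP u).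
pose f : {linear V -> R^o} := HB.pack (ip u : V -> R^o) m.
have fE x : linfun f x = ip u x by rewrite lfunE.
pose U' := (U :&: lker (linfun f))%VS.
have memU' x : (x \in U') = (x \in U) && (ip u x == 0).
  by rewrite memv_cap memv_ker fE.
have ltU' : (\dim U' < \dim U)%N.
  rewrite ltn_neqAle dimvS ?capvSl // andbT; apply/negP => dimE.
  have /eqP eqU : (U' == U)%VS by rewrite eqEdim capvSl /= (eqP dimE).
  by have := uU; rewrite -eqU memU' uu oner_eq0 andbF.
have [s [sU' sP]] := IHn U' (leq_trans ltU' ltUn).
exists (u :: s); split=> [v|x xU].
  by rewrite inE => /predU1P[->//|/sU']; rewrite memU' => /andP[].
have xU' : x - ip u x *: u \in U'.
  rewrite memU' rpredB ?rpredZ //=.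
  by rewrite ipDr // ipNr // ipZr // uu mulr1 subrr.
rewrite big_cons -{1}[x](subrK (ip u x *: u)) addrC; congr (_ + _).
rewrite {1}(sP _ xU') !big_seq; apply: eq_bigr => v /sU'.
rewrite memU' => /andP[_ /eqP uv].
by rewrite ipDr // ipNr // ipZr // (ipC ipP v u) uv mulr0 subr0.
Qed.

(** The expansion formula of a frame of [U], evaluated at an [x] that need not lie in [U], gives the
    projection. *)
Lemma orthogonal_projection (U : {vspace V}) x :
  exists2 y, y \in U & {in U, forall z, ip z y = ip z x}.
Proof.
have [s [sU sP]] := parseval_frame U.
exists (\sum_(v <- s) ip v x *: v).
  by rewrite big_seq; apply: rpred_sum => v /sU vU; rewrite rpredZ.
move=> z zU; rewrite ip_sumr // [in RHS](sP z zU) ip_suml //.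
by apply: eq_bigr => v _; rewrite ipZl // ipZr // mulrC (ipC ipP z).
Qed.

Variable s : seq V.
Hypothesis sP : forall x, x = \sum_(v <- s) ip v x *: v.

(** Expand the basis vectors in the frame and exchange the sums; what remains is the basis expansion
    of each [h v]. Linear independence of the frame does not enter. *)
Lemma lftrace_frame (h : 'End(V)) : lftrace h = \sum_(v <- s) ip v (h v).
Proof.
pose e := vbasis (fullv : {vspace V}).
have eP x : x = \sum_i coord e i x *: e`_i.
  by rewrite -coord_vbasis ?memvf.
have -> : lftrace h = \sum_i coord e i (h e`_i).
  apply: eq_bigr => i _; rewrite !mxE /=.
  by rewrite passmx.vecof_delta.
under eq_bigr => i _.
  rewrite [X in h X]sP !linear_sum /=.
  under eq_bigr do rewrite !linearZ /=.
  over.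
rewrite exchange_big; apply: eq_bigr => v _.
rewrite [in RHS](eP (h v)) ip_sumr //; apply: eq_bigr => i _.
by rewrite ipZr // mulrC.
Qed.

End ParsevalFrame.

Lemma lin_fun_homE (R : fieldType) (V E : vectType R) (f : V -> E) :
  linear f -> linfun f =1 f.
Proof.
move=> fl x; pose m := GRing.isLinear.Build _ _ _ _ f fl.
pose h : {linear V -> E} := HB.pack f m.
exact: (lfunE h).
Qed.

Lemma ev2B (R : fieldType) (V E : vectType R) (k l : tens2 V E) x y :
  ev2 (k - l) x y = ev2 k x y - ev2 l x y.
Proof. by rewrite /ev2 !(add_lfunE, opp_lfunE). Qed.

Lemma ricB (R : fieldType) (V : vectType R) (k l : tens2 V 'End(V)) :
  ric (k - l) = ric k - ric l.
Proof. by rewrite addrC -scaleN1r ric_is_linear scaleN1r addrC. Qed.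

(** * The Ricci trace as an adjoint, for an abstract algebra *)

Section RicciAdjoint.
Variables (R : rcfType) (V E : vectType R).
Variables (ip : V -> V -> R) (form : E -> E -> R).
(** [E] is a space of matrices, or of pairs of matrices, that parametrises g through [act], possibly
    with a kernel. [D x p] stands for x p^H, and [form_D] below is the adjunction behind the Ricci
    trace. *)
Variables (act : E -> 'End(V)) (D : V -> V -> E).
Hypotheses (ipP : inner_product ip) (formP : inner_product form).
Hypotheses (act_lin : linear act).
Hypotheses (D_linl : forall y, linear (D^~ y)).
Hypotheses (D_linr : forall x, linear (D x)).
Hypothesis act_D_sym : forall x p y, act (D x p) y = act (D y p) x.
Hypothesis form_D : forall x p a, form (D x p) a = ip x (act a p).

Variable g : set 'End(V).
Hypothesis gP : forall f, g f <-> exists a, f = act a.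

Let actB a b : act (a - b) = act a - act b.
Proof. by rewrite addrC -scaleN1r act_lin scaleN1r addrC. Qed.

Let g_sub f h : g f -> g h -> g (f - h).
Proof.
by rewrite !gP => -[a ->] [b ->]; exists (a - b); rewrite actB.
Qed.

(** Serves to establish [prolongP], which is assumed only afterwards: a well-chosen [p] normalises
    [phi], and the normalised element is then shown to vanish. *)
Lemma prolong_sub (phi : 'Hom(V, 'End(V))) p : prolong g phi ->
  exists2 psi : 'Hom(V, 'End(V)),
    prolong g psi & forall x, psi x = phi x - act (D x p).
Proof.
move=> [gphi phiC]; pose f x := act (D x p).
have fl : linear f by move=> a u v; rewrite /f D_linl act_lin.
have psiE x : (phi - linfun f) x = phi x - act (D x p).
  by rewrite add_lfunE opp_lfunE (lin_fun_homE fl).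
exists (phi - linfun f) => //; split=> [x|x y].
  by rewrite psiE; apply: g_sub => //; apply/gP; exists (D x p).
by rewrite !psiE !add_lfunE !opp_lfunE phiC act_D_sym.
Qed.

Hypothesis prolongP : forall phi : 'Hom(V, 'End(V)),
  prolong g phi -> exists p, forall x, phi x = act (D x p).

Section Frame.
Variable s : seq V.
Hypothesis sP : forall x, x = \sum_(v <- s) ip v x *: v.

Lemma linear_frame (W : lmodType R) (f : V -> W) : linear f ->
  forall x, f x = \sum_(v <- s) ip v x *: f v.
Proof.
move=> fl x; pose m := GRing.isLinear.Build _ _ _ _ f fl.
pose h : {linear V -> W} := HB.pack f m.
rewrite -[f]/(h : V -> W) {1}[x]sP linear_sum.
by apply: eq_bigr => v _; rewrite linearZ.
Qed.

Lemma ev2_frame (W : vectType R) (k l : tens2 V W) :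
  {in s &, forall v w, ev2 k v w = ev2 l v w} -> k = l.
Proof.
move=> kl; apply/ev2P => x y.
rewrite (linear_frame (ev2_linl k y)) (linear_frame (ev2_linl l y)).
rewrite !big_seq; apply: eq_bigr => v sv; congr (_ *: _).
rewrite (linear_frame (ev2_linr k v)) (linear_frame (ev2_linr l v)).
by rewrite !big_seq; apply: eq_bigr => w sw; rewrite kl.
Qed.

Lemma ric_frame k x y : ev2 (ric k) x y = \sum_(v <- s) ip v (ev2 k x v y).
Proof.
rewrite ricE (lftrace_frame ipP sP); apply: eq_bigr => v _.
rewrite lin_fun_homE // => a u w.
by rewrite ev2_linr add_lfunE scale_lfunE.
Qed.

(* Ric is half the adjoint of q |-> (x, y |-> D y (q x) - D x (q y)), computed
   on arbitrary preimages L under act of the values of k. *)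
Lemma ric_adjoint (k : tens2 V 'End(V)) (L : V -> V -> E) (q : V -> V) :
  (forall x, ev2 k x x = 0) ->
  {in s &, forall v w, ev2 k v w = act (L v w)} ->
  \sum_(v <- s) \sum_(w <- s) form (D w (q v) - D v (q w)) (L v w) =
  (\sum_(v <- s) ev2 (ric k) v (q v)) *+ 2.
Proof.
move=> kalt kL.
have kC x y : ev2 k x y = - ev2 k y x.
  have := kalt (x + y); rewrite /ev2 !linearD /= !add_lfunE -!/(ev2 k _ _).
  rewrite !kalt add0r addr0 addrC => /eqP; rewrite addr_eq0 => /eqP.
  exact.
have SE : \sum_(v <- s) ev2 (ric k) v (q v) =
  \sum_(v <- s) \sum_(w <- s) ip w (ev2 k v w (q v)).
  by apply: eq_bigr => v _; rewrite ric_frame.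
(* In one of the two copies of the sum, v and w are exchanged; the sign coming from [kC] matches the
   second term of the 2-form. *)
rewrite mulr2n {2}SE [X in _ + X]exchange_big SE -big_split /=.
rewrite [LHS]big_seq [RHS]big_seq; apply: eq_bigr => v sv.
rewrite -big_split /= [LHS]big_seq [RHS]big_seq; apply: eq_bigr => w sw.
by rewrite ipBl // !form_D -kL // [ev2 k w v]kC opp_lfunE ipNr.
Qed.

End Frame.

(** Sends V^* (x) V to V^* (x) g^(1) through the embedding of V in g^(1); composing with [antisym2]
    gives the map d. *)
Definition bracket (p : 'End(V)) : tens2 V 'End(V) :=
  linfun (fun x => linfun (fun y => act (D y (p x)))).

Lemma bracketE p x y : ev2 (bracket p) x y = act (D y (p x)).
Proof.
rewrite bilin_homE // => z a u v;
  by rewrite ?linearP /= ?D_linr ?D_linl act_lin.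
Qed.

Lemma prolong_bracket p x : prolong g (bracket p x).
Proof.
have bE z : (bracket p x : 'Hom(V, 'End(V))) z = act (D z (p x)).
  exact: bracketE.
by split=> y; rewrite ?bE ?gP; [exists (D y (p x))|move=> z; rewrite !bE].
Qed.

(** Each [psi x] is symmetric in its two arguments, so the six terms of the cyclic sum cancel in
    pairs. *)
Lemma im_antisym2_curv : im_antisym2 g `<=` curv g.
Proof.
move=> _ [psi psiP <-]; split; first split.
- move=> x y; rewrite antisym2E; apply: g_sub.
    by case: (psiP x) => /(_ y).
  by case: (psiP y) => /(_ x).
- by move=> x; rewrite antisym2E subrr.
- move=> x y z; rewrite /antisym3 !antisym2E !add_lfunE !opp_lfunE /ev2.
  have [_ Sx] := psiP x; have [_ Sy] := psiP y; have [_ Sz] := psiP z.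
  rewrite (Sx y z) (Sy z x) (Sz x y).
  by rewrite !addrA !subrK subrr.
Qed.

Lemma ric_set_bij : set_bij (im_antisym2 g) (ric_space g)
  (@ric R V : {linear tens2 V 'End(V) -> tens2 V R^o}).
Proof.
have [s [_ sP]] := parseval_frame ipP fullv.
have {}sP x : x = \sum_(v <- s) ip v x *: v by apply: sP; rewrite memvf.
split.
- by move=> k /im_antisym2_curv kg; exists k.
- move=> _ _ /set_mem[psi1 psi1P <-] /set_mem[psi2 psi2P <-] ric12.
  pose psi := psi1 - psi2; pose k := antisym2 psi.
  have kE : k = antisym2 psi1 - antisym2 psi2.
    apply/ev2P => x y; rewrite ev2B !antisym2E !ev2B !opprB.
    by rewrite addrACA [RHS]addrACA; congr (_ + _); rewrite addrC.
  suff : k = 0 by rewrite kE => /eqP; rewrite subr_eq0 => /eqP.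
  have psiP x : prolong g (psi x).
    have [[g1 S1] [g2 S2]] := (psi1P x, psi2P x).
    have psiE y : (psi x : 'Hom(V, 'End(V))) y = ev2 psi1 x y - ev2 psi2 x y.
      exact: ev2B.
    split=> [y|y z]; rewrite !psiE; first by
      apply: g_sub; [exact: g1|exact: g2].
    rewrite !add_lfunE !opp_lfunE. congr (_ - _); [exact: S1|exact: S2].
  (* [q] is a mere function; this suffices, because [ric_adjoint] only evaluates it on the frame. *)
  have [q qE] := choice (fun x => prolongP (psiP x)).
  pose L x y := D y (q x) - D x (q y).
  have kL x y : ev2 k x y = act (L x y).
    by rewrite antisym2E actB /ev2 !qE.
  have kalt x : ev2 k x x = 0 by rewrite antisym2E subrr.
  (* The left side is the sum of the squared norms of [L] over pairs of frame vectors. It vanishes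
     with [ric k], so [L], and hence [k], vanishes on the frame. *)
  have := ric_adjoint sP q kalt (in2W kL).
  have {ric12} ric12 : ric (antisym2 psi1) = ric (antisym2 psi2) := ric12.
  have ric0 : ric k = 0 by rewrite kE ricB ric12 subrr.
  rewrite ric0.
  rewrite [in RHS]big1 ?mul0rn => [S0|v _]; last by rewrite /ev2 !lfunE.
  apply: (ev2_frame sP) => v w sv sw; rewrite kL [RHS]/ev2 !lfunE.
  have : form (L v w) (L v w) = 0.
    have L0 x y : 0 <= form (L x y) (L x y) by exact: ip_ge0.
    move/eqP: S0; rewrite psumr_eq0 => [/allP/(_ v sv)/=|x _]; last first.
      by apply: sumr_ge0 => *; exact: L0.
    by rewrite psumr_eq0 => [/allP/(_ w sw)/eqP|y _]; last exact: L0.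
  by move=> /(ip_eq0 formP) ->; rewrite -[0](subrr 0) actB subrr.
- move=> _ [k [[kg kalt] kB] <-].
  have [L kL] : exists L : V -> V -> E, forall x y, ev2 k x y = act (L x y).
    have /choice[L LE] : forall xy : V * V, exists a, ev2 k xy.1 xy.2 = act a.
      by move=> xy; apply/gP.
    by exists (fun x y => L (x, y)) => x y; exact: LE (x, y).
  (* [L] is not known to be bilinear, so the projection takes place among families indexed by pairs
     of frame vectors, where [L] is a vector and [M] plays the role of d. *)
  pose n := size s; pose Y := {ffun 'I_n * 'I_n -> E}.
  pose M (p : 'End(V)) : Y := [ffun ij : 'I_n * 'I_n =>
    D s`_ij.2 (p s`_ij.1) - D s`_ij.1 (p s`_ij.2)].
  have Ml : linear M.
    move=> a p1 p2; apply/ffunP => ij; rewrite !ffunE !add_lfunE !scale_lfunE.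
    by rewrite !D_linr scalerBr opprD addrACA.
  pose formY (f h : Y) := \sum_ij form (f ij) (h ij).
  have formYP : inner_product formY by exact: ffun_inner_product.
  have [_ /memv_imgP[p _ ->]] := orthogonal_projection formYP
    (limg (linfun M)) [ffun ij : 'I_n * 'I_n => L s`_ij.1 s`_ij.2].
  rewrite lin_fun_homE // => Mp.
  have formYE q h : formY (M q) [ffun ij : 'I_n * 'I_n => h s`_ij.1 s`_ij.2] =
    \sum_(v <- s) \sum_(w <- s) form (D w (q v) - D v (q w)) (h v w).
    rewrite [RHS](big_nth 0) big_mkord.
    under eq_bigr do rewrite (big_nth 0) big_mkord.
    rewrite pair_big; apply: eq_bigr => ij _.
    by rewrite !ffunE.
  exists (antisym2 (bracket p)).
    by exists (bracket p) => // x; apply: prolong_bracket.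
  apply/ev2P => x y.
  (* Pairing with this rank-one map extracts the single value of a Ricci tensor at (x, y). *)
  pose q : 'End(V) := linfun (fun v => ip x v *: y).
  have qE v : q v = ip x v *: y.
    rewrite lin_fun_homE // => a u w.
    by rewrite ipDr // ipZr // scalerDl scalerA.
  have ricq h : \sum_(v <- s) ev2 (ric h) v (q v) = ev2 (ric h) x y.
    rewrite (linear_frame sP (ev2_linl _ _)); apply: eq_bigr => v _.
    by rewrite qE /ev2 linearZ ipC.
  have := Mp (M q); rewrite -{1}(lin_fun_homE Ml q) memv_img ?memvf //.
  move=> /(_ isT).
  have -> : M p = [ffun ij : 'I_n * 'I_n =>
      (fun v w => D w (p v) - D v (p w)) s`_ij.1 s`_ij.2].
    by apply/ffunP => ij; rewrite !ffunE.
  rewrite (formYE q (fun v w => D w (p v) - D v (p w))) (formYE q L).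
  rewrite (ric_adjoint sP q kalt (in2W kL)).
  rewrite (@ric_adjoint s sP (antisym2 (bracket p))) //.
  - rewrite !ricq => /eqP; rewrite -subr_eq0 -mulrnBl mulrn_eq0 /= subr_eq0.
    by move/eqP.
  - by move=> z; rewrite antisym2E subrr.
  - by move=> z w _ _; rewrite antisym2E !bracketE actB.
Qed.
End RicciAdjoint.

(** * Adjoint matrices and real scalars *)

Section AdjointMatrix.
Variables (F : nzRingType) (sigma : F -> F).
Hypotheses (sD : {morph sigma : a b / a + b}).
Hypotheses (sM : forall a b, sigma (a * b) = sigma b * sigma a).

Let s0 : sigma 0 = 0.
Proof. by apply: (addrI (sigma 0)); rewrite -sD !addr0. Qed.

Lemma adjmxD m n (A B : 'M[F]_(m, n)) :
  adjmx sigma (A + B) = adjmx sigma A + adjmx sigma B.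
Proof. by apply/matrixP => i j; rewrite !mxE sD. Qed.

Lemma adjmxM m n p (A : 'M[F]_(m, n)) (B : 'M[F]_(n, p)) :
  adjmx sigma (A *m B) = adjmx sigma B *m adjmx sigma A.
Proof.
apply/matrixP => i j; rewrite !mxE (big_morph sigma sD s0).
by apply: eq_bigr => k _; rewrite !mxE sM.
Qed.

Lemma adjmxK m n : involutive sigma ->
  cancel (@adjmx _ sigma m n) (@adjmx _ sigma n m).
Proof. by move=> sK A; apply/matrixP => i j; rewrite !mxE sK. Qed.

End AdjointMatrix.

Lemma adjmxC (F : Type) (sigma tau : F -> F) m n (A : 'M[F]_(m, n)) :
  (forall a, sigma (tau a) = tau (sigma a)) ->
  adjmx sigma (adjmx tau A) = adjmx tau (adjmx sigma A).
Proof. by move=> st; apply/matrixP => i j; rewrite !mxE st. Qed.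

Section RealScaling.
Variables (R : fieldType) (F : falgType R).

Lemma resmx_scalemul m n p (a : R) (A : resmx F m n) (B : resmx F n p) :
  (a *: A) *m B = a *: (A *m B : resmx F m p).
Proof.
apply/matrixP => i j; rewrite !mxE scaler_sumr; apply: eq_bigr => k _.
by rewrite mxE scalerAl.
Qed.

Lemma resmx_mulscale m n p (a : R) (A : resmx F m n) (B : resmx F n p) :
  A *m (a *: B) = a *: (A *m B : resmx F m p).
Proof.
apply/matrixP => i j; rewrite !mxE scaler_sumr; apply: eq_bigr => k _.
by rewrite mxE scalerAr.
Qed.

Lemma resmx_scaleDr m n (a : R) (A B : 'M[F]_(m, n)) :
  a *: (A + B : resmx F m n) =
  (a *: (A : resmx F m n) : 'M[F]_(m, n)) + a *: (B : resmx F m n).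
Proof. by rewrite -(scalerDr a (A : resmx F m n)). Qed.

Lemma resmx_adjscale (sigma : F -> F) m n (a : R) (A : resmx F m n) :
  scalable sigma ->
  adjmx sigma (a *: A) = a *: (adjmx sigma A : resmx F n m).
Proof. by move=> sZ; apply/matrixP => i j; rewrite !mxE sZ. Qed.

End RealScaling.

(** * Algebras with a positive conjugation, and the inner product Re tr (A^H B) *)

Record conj_algebra (R : realFieldType) (F : falgType R)
    (conj : F -> F) (re : F -> R) : Prop := ConjAlgebra {
  conj_linear : linear conj;
  conjM : forall a b, conj (a * b) = conj b * conj a;
  conjK : involutive conj;
  re_scalar : scalar re;
  reC : forall a b, re (a * b) = re (b * a);
  re_conj : forall a, re (conj a) = re a;
  re_gt0 : forall a, a != 0 -> 0 < re (conj a * a) }.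

Section MatrixInnerProduct.
Variables (R : realFieldType) (F : falgType R) (conj : F -> F) (re : F -> R).
Hypothesis cF : conj_algebra conj re.

Local Notation "A ^H" := (adjmx conj A) (at level 8, format "A ^H").

Lemma conjD a b : conj (a + b) = conj a + conj b.
Proof. by rewrite -[a in LHS]scale1r (conj_linear cF) scale1r. Qed.

Lemma conj0 : conj 0 = 0.
Proof. by apply: (addrI (conj 0)); rewrite -conjD !addr0. Qed.

Lemma conjZ : scalable conj.
Proof. by move=> a x; rewrite -[a *: x]addr0 (conj_linear cF) conj0 addr0. Qed.

Lemma reD a b : re (a + b) = re a + re b.
Proof. by rewrite -[a in LHS]scale1r (re_scalar cF) mul1r. Qed.

Lemma re0 : re 0 = 0.
Proof. by apply: (addrI (re 0)); rewrite -reD !addr0. Qed.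

Lemma reZ a x : re (a *: x) = a * re x.
Proof. by rewrite -[a *: x]addr0 (re_scalar cF) re0 addr0. Qed.

Lemma re_sum (I : Type) (r : seq I) (P : pred I) (f : I -> F) :
  re (\sum_(i <- r | P i) f i) = \sum_(i <- r | P i) re (f i).
Proof. exact: (big_morph re reD re0). Qed.

Definition retr n (A : 'M[F]_n) := re (\tr A).

Lemma retrD n (A B : 'M[F]_n) : retr (A + B) = retr A + retr B.
Proof. by rewrite /retr mxtraceD reD. Qed.

Lemma retr0 n : retr (0 : 'M[F]_n) = 0.
Proof. by rewrite /retr mxtrace0 re0. Qed.

(** Over the quaternions the trace itself is not cyclic, only its real part; hence all trace forms
    below are taken with [re]. *)
Lemma retrC m n (A : 'M[F]_(m, n)) (B : 'M[F]_(n, m)) :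
  retr (A *m B) = retr (B *m A).
Proof.
rewrite /retr !re_sum; under eq_bigr do rewrite mxE re_sum.
rewrite exchange_big; apply: eq_bigr => i _; rewrite mxE re_sum.
by apply: eq_bigr => j _; rewrite (reC cF).
Qed.

Lemma retr_adj (sigma : F -> F) n (A : 'M[F]_n) :
  (forall a, re (sigma a) = re a) -> retr (adjmx sigma A) = retr A.
Proof.
by move=> sr; rewrite /retr !re_sum; apply: eq_bigr => i _; rewrite !mxE sr.
Qed.

Definition mxip m n (A B : resmx F m n) : R := retr (A^H *m B).

Lemma mxipE m n (A B : resmx F m n) :
  mxip A B = \sum_i \sum_j re (conj (A i j) * B i j).
Proof.
rewrite exchange_big /mxip /retr re_sum; apply: eq_bigr => j _.
by rewrite mxE re_sum; apply: eq_bigr => i _; rewrite !mxE.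
Qed.

Lemma mx_inner_product m n : inner_product (@mxip m n).
Proof.
split=> [B a A C|A B|A].
- rewrite !mxipE mulr_sumr -big_split /=; apply: eq_bigr => i _.
  rewrite mulr_sumr -big_split /=; apply: eq_bigr => j _.
  by rewrite !mxE (conj_linear cF) mulrDl reD -scalerAl reZ.
- rewrite !mxipE; apply: eq_bigr => i _; apply: eq_bigr => j _.
  by rewrite -(re_conj cF) (conjM cF) (conjK cF).
- move=> A0.
  have sq_ge0 a : 0 <= re (conj a * a).
    have [->|/(re_gt0 cF)/ltW//] := eqVneq a 0.
    by rewrite mulr0 re0.
  case: (pickP (fun ij => A ij.1 ij.2 != 0)) => [[i j] /= Aij|A00]; last first.
    case/eqP: A0; apply/matrixP => i j; rewrite mxE; apply/eqP.
    by have /negbFE := A00 (i, j).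
  rewrite mxipE (bigD1 i) //= ltr_wpDr ?sumr_ge0 // => [k _|].
    by rewrite sumr_ge0.
  by rewrite (bigD1 j) //= ltr_wpDr ?sumr_ge0 // (re_gt0 cF).
Qed.

End MatrixInnerProduct.

(** With [simp_deltas] and [distinct], this evaluates the Kronecker deltas of an identity on matrix
    units when the indices are pairwise distinct. *)
Ltac neqs := repeat match goal with
  | H : is_true (?x != ?y) |- context [?x == ?y] => rewrite (negPf H)
  | H : is_true (?x != ?y) |- context [?y == ?x] =>
      rewrite (eq_sym y x) (negPf H)
  end.

Ltac simp_deltas := rewrite ?(mulr0n, mulr1n, subr0, sub0r, add0r, addr0).

Ltac distinct := rewrite /= ?inE ?negb_or -?andbA;
  let H := fresh "neq" in intro H;
  repeat match goal with
  | K : is_true (_ && _) |- _ => apply (elimT andP) in K; destruct K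
  end.

(** * gl(n, F) acting on symmetric, alternating and Hermitian matrices *)

Section HermitianAction.
Variables (R : rcfType) (F : falgType R) (conj : F -> F) (re : F -> R).
Hypothesis cF : conj_algebra conj re.
(** Two involutions are in play: [sigma] defines V and the action, [conj] the inner product. They
    differ for symmetric and alternating complex matrices, where [sigma] is the identity. *)
Variables (sigma : {linear F -> F}) (e : R) (n : nat).
Hypotheses (sigmaM : forall a b, sigma (a * b) = sigma b * sigma a).
Hypotheses (sigmaK : involutive sigma) (ee : e * e = 1).
Hypotheses (sigmaC : forall a, sigma (conj a) = conj (sigma a)).
Hypotheses (sigma_re : forall a, re (sigma a) = re a).

Local Notation M := (resmx F n n).
Local Notation H := (herm sigma e n).
Local Notation V := (subvs_of H).
Local Notation "A ^H" := (adjmx conj A) (at level 8, format "A ^H").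
Local Notation "A ^s" := (adjmx sigma A) (at level 8, format "A ^s").
Local Notation tau := (retr re).

Let sDm p q (A B : 'M[F]_(p, q)) : (A + B)^s = A^s + B^s.
Proof. exact/adjmxD/linearD. Qed.

Let sMm p q r (A : 'M[F]_(p, q)) (B : 'M[F]_(q, r)) : (A *m B)^s = B^s *m A^s.
Proof. by apply: adjmxM => // a b; rewrite linearD. Qed.

Let sKm p q (A : 'M[F]_(p, q)) : (A^s)^s = A.
Proof. exact: adjmxK. Qed.

Let sZm (a : R) (A : M) : (a *: A)^s = a *: (A^s : M).
Proof. by apply: resmx_adjscale => b x; rewrite linearZ. Qed.

Let cDm p q (A B : 'M[F]_(p, q)) : (A + B)^H = A^H + B^H.
Proof. exact/adjmxD/(conjD cF). Qed.

Let cMm p q r (A : 'M[F]_(p, q)) (B : 'M[F]_(q, r)) : (A *m B)^H = B^H *m A^H.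
Proof. exact/adjmxM/(conjM cF)/(conjD cF). Qed.

Let cKm p q (A : 'M[F]_(p, q)) : (A^H)^H = A.
Proof. exact/adjmxK/(conjK cF). Qed.

Let cZm (a : R) (A : M) : (a *: A)^H = a *: (A^H : M).
Proof. exact/resmx_adjscale/(conjZ cF). Qed.

Let scm (A : M) : (A^H)^s = (A^s)^H.
Proof. exact/adjmxC. Qed.

Lemma vsval_herm (S : V) : (vsval S)^s = e *: vsval S.
Proof. by apply/eqP; rewrite -mem_herm subvsP. Qed.

Lemma herm_conj (S : M) : S \in H -> S^H \in H.
Proof. by rewrite !mem_herm scm => /eqP ->; rewrite cZm. Qed.

Definition gl_act_fun (A : M) (S : V) : V :=
  vsproj H (A *m vsval S + vsval S *m A^s).

Lemma gl_act_funE A S :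
  vsval (gl_act_fun A S) = A *m vsval S + vsval S *m A^s :> 'M[F]_n.
Proof.
rewrite vsprojK // mem_herm sDm !sMm sKm vsval_herm.
by rewrite resmx_scalemul resmx_mulscale -resmx_scaleDr addrC.
Qed.

Lemma gl_act_fun_linear A : linear (gl_act_fun A).
Proof.
move=> a S T; apply: val_inj; rewrite /= !gl_act_funE /=.
by rewrite mulmxDr mulmxDl resmx_scalemul resmx_mulscale addrACA -resmx_scaleDr.
Qed.

Definition gl_act (A : M) : 'End(V) := linfun (gl_act_fun A).

Lemma gl_actE A S :
  vsval (gl_act A S) = A *m vsval S + vsval S *m A^s :> 'M[F]_n.
Proof. by rewrite (lin_fun_homE (gl_act_fun_linear A)) gl_act_funE. Qed.

Lemma gl_act_linear : linear gl_act.
Proof.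
move=> a A B; apply/lfunP => S; apply: val_inj.
rewrite /= add_lfunE scale_lfunE /= !gl_actE.
rewrite sDm sZm mulmxDl mulmxDr resmx_scalemul resmx_mulscale.
by rewrite addrACA -resmx_scaleDr.
Qed.

Lemma gl_hermP f : gl_herm f <-> exists A, f = gl_act A.
Proof.
split=> [[A fA]|[A ->]]; exists A; last exact: gl_actE.
by apply/lfunP => S; apply: val_inj; rewrite /= fA gl_actE.
Qed.

Definition herm_box (S T : V) : M := vsval S *m (vsval T)^H.

(** Both S and T^H are multiplied by [e] under the sigma-adjoint, so that of S T^H is T^H S, the
    signs cancelling by [ee]. This is why the action becomes the triple product, symmetric in S and
    U. *)
Lemma gl_act_box S T U : vsval (gl_act (herm_box S T) U) =
  vsval S *m (vsval T)^H *m vsval U + vsval U *m (vsval T)^H *m vsval S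
  :> 'M[F]_n.
Proof.
rewrite gl_actE sMm scm !vsval_herm cZm resmx_scalemul !resmx_mulscale.
by rewrite scalerA ee scale1r mulmxA.
Qed.

Lemma herm_box_linl T : linear (herm_box^~ T).
Proof.
by move=> a S U; rewrite /herm_box /= mulmxDl resmx_scalemul.
Qed.

Lemma herm_box_linr S : linear (herm_box S).
Proof.
move=> a T U; rewrite /herm_box /= cDm cZm mulmxDr.
by rewrite resmx_mulscale.
Qed.

Lemma gl_act_box_sym S T U : gl_act (herm_box S T) U = gl_act (herm_box U T) S.
Proof. by apply: val_inj; rewrite /= !gl_act_box addrC. Qed.

(** Taking the sigma-adjoint under the real trace and permuting cyclically turns one half of the
    action on T into the other; the factor 2 counts these equal halves. *)
Lemma mxip_box S T (A : M) : mxip conj re (herm_box S T) A *+ 2 =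
  mxip conj re (vsval S) (vsval (gl_act A T)).
Proof.
rewrite /mxip gl_actE mulmxDr (retrD cF) mulr2n /herm_box cMm cKm.
rewrite -!mulmxA; congr (_ + _).
  by rewrite (retrC cF) -!mulmxA.
rewrite (retrC cF) -!mulmxA -[RHS](retr_adj cF _ sigma_re) !sMm sKm scm.
rewrite !vsval_herm cZm !(resmx_scalemul, resmx_mulscale) scalerA ee scale1r.
rewrite (retrC cF) -!mulmxA.
by rewrite (retrC cF) -!mulmxA.
Qed.

(** * The prolongation when V contains an invertible matrix *)

Section Unital.
Variables (U T : V).
Hypotheses (UT : vsval U *m vsval T = 1%:M :> 'M[F]_n).
Hypotheses (TU : vsval T *m vsval U = 1%:M :> 'M[F]_n).

Let u : 'M[F]_n := vsval U.
Let t : 'M[F]_n := vsval T.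
Let ut : u *m t = 1%:M. Proof. exact: UT. Qed.
Let tu : t *m u = 1%:M. Proof. exact: TU. Qed.

Let tau_ut (B : 'M[F]_n) : tau (u *m B *m t) = tau B.
Proof. by rewrite (retrC cF) mulmxA tu mul1mx. Qed.

(** Tested on z = u v^H u, the form becomes the squared norm of v. *)
Lemma unit_form_eq0 (v : V) :
  (forall z : V, tau (vsval v *m t *m vsval z *m t) = 0) -> v = 0.
Proof.
move=> v0; pose z : M := vsval U *m (vsval v)^H *m vsval U.
have zH : z \in H.
  rewrite mem_herm /z !sMm scm !vsval_herm cZm.
  by rewrite !(resmx_scalemul, resmx_mulscale) !scalerA ee mul1r mulmxA.
have := v0 (vsproj H z); rewrite vsprojK // /z -/u.
rewrite -!mulmxA ut mulmx1 (mulmxA t) tu mul1mx (retrC cF) => vv.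
have [_ _ p] := mx_inner_product cF n n.
apply: val_inj; rewrite /=; apply/eqP/negP => /negP /p.
by rewrite /mxip vv ltxx.
Qed.

(* With s x = phi(x)U, the sum h x y z + h x z y depends on s x only, so s
   determines the form h (Koszul); comparing h U y z with its definition then
   forces s = 0. *)
Lemma prolong_unit_eq0 (phi : 'Hom(V, 'End(V))) :
  prolong (@gl_herm R F sigma e n) phi -> phi U U = 0 -> phi = 0.
Proof.
move=> [phig phiC] phiU.
pose s (x : V) : 'M[F]_n := vsval (phi U x).
pose h (x y z : V) := tau (vsval (phi x y) *m t *m vsval z *m t).
have hC (x y z : V) : h x y z = h y x z by rewrite /h phiC.
have hE (x y z : V) : h x y z + h x z y =
    tau (s x *m t *m vsval y *m t *m vsval z *m t) +
    tau (s x *m t *m vsval z *m t *m vsval y *m t).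
  (* Here phi(x) y = A y + y A' and s x = A u + u A'. The terms in A agree at once, those in A'
     after a cyclic permutation and a conjugation by u, which [tau] ignores. *)
  have [A phiA] := phig x; rewrite /h /s (phiC U x) !phiA -/u.
  move: (vsval y : 'M[F]_n) (vsval z : 'M[F]_n) (A^s) => y' z' A'.
  rewrite !mulmxDl !(retrD cF) -!(mulmxA A u t) ut mulmx1.
  rewrite -(mulmxA u A') -(mulmxA u (A' *m t)) -(mulmxA u (A' *m t *m y')).
  rewrite -(mulmxA u (A' *m t *m y' *m t)) tau_ut.
  rewrite -(mulmxA u (A' *m t)) -(mulmxA u (A' *m t *m z')).
  rewrite -(mulmxA u (A' *m t *m z' *m t)) tau_ut.
  rewrite (retrC cF _ z') (retrC cF _ y') !mulmxA.
  ring.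
have hU (x z : V) : h x U z = tau (s x *m t *m vsval z *m t).
  by rewrite /h phiC.
have hUr (x z : V) : h x z U = tau (s x *m t *m vsval z *m t).
  have := hE x U z; rewrite hU -/u -!mulmxA (mulmxA t u) tu mul1mx !mulmxA.
  rewrite -[in X in _ = _ + X](mulmxA _ t u) tu mulmx1 => /addrI; exact.
have s0 x : phi U x = 0.
  apply: unit_form_eq0 => z; rewrite -/(s x).
  have sC : tau (s x *m t *m vsval z *m t) = tau (s z *m t *m vsval x *m t).
    by rewrite -!hUr hC.
  (* At U the right side of [hE] contains s U = phi(U)U = 0, while both terms on the left equal the
     form in s x. *)
  have := hE U x z; rewrite ![h U _ _]hC !hU -sC.
  rewrite /s phiU !mul0mx (retr0 cF) addr0 => /eqP.
  by rewrite -mulr2n mulrn_eq0 => /eqP.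
have hN x y z : h x y z = - h x z y.
  by apply/eqP; rewrite -addr_eq0 hE /s s0 !mul0mx (retr0 cF) addr0.
apply/lfunP => x; apply/lfunP => y; rewrite !lfunE /=.
apply: unit_form_eq0 => z; rewrite -/(h x y z).
(* [h] is symmetric in its first two and antisymmetric in its last two arguments; six alternate
   exchanges return to the start with a minus sign. *)
have hh : h x y z = - h x y z.
  by rewrite {1}hN hC hN opprK hC hN hC.
have /eqP : h x y z *+ 2 = 0 by rewrite mulr2n {1}hh addNr.
by rewrite mulrn_eq0 => /eqP.
Qed.

Lemma prolong_unit (phi : 'Hom(V, 'End(V))) :
  prolong (@gl_herm R F sigma e n) phi ->
  exists p, forall x, phi x = gl_act (herm_box x p).
Proof.
move=> phiP; pose v : 'M[F]_n := vsval (phi U U).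
(* Solves 2 u p^H u = phi(U)U, so that subtracting the element given by [p] makes phi(U)U vanish. *)
pose p : M := 2^-1 *: ((t *m v *m t)^H : M).
have pH : p \in H.
  rewrite rpredZ // herm_conj // mem_herm !sMm !vsval_herm.
  by rewrite !(resmx_scalemul, resmx_mulscale) !scalerA ee mul1r mulmxA.
have [psi psiP psiE] := prolong_sub gl_act_linear herm_box_linl gl_act_box_sym
  gl_hermP (vsproj H p) phiP.
exists (vsproj H p) => x; apply/eqP; rewrite -subr_eq0 -psiE.
rewrite (prolong_unit_eq0 psiP) ?lfunE //; apply/eqP.
rewrite psiE add_lfunE opp_lfunE subr_eq0; apply/eqP/val_inj.
rewrite /= gl_act_box vsprojK // cZm cKm -/u -/v.
rewrite resmx_mulscale resmx_scalemul -!mulmxA tu mulmx1 !mulmxA ut mul1mx.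
apply/matrixP => i j; rewrite !mxE -scalerDl.
have -> : 2^-1 + 2^-1 = 1 :> R by field.
by rewrite scale1r.
Qed.

End Unital.

Lemma scalar_herm (a : F) : sigma a = e *: a -> (a%:M : M) \in H.
Proof.
move=> sa; rewrite mem_herm; apply/eqP/matrixP => i j; rewrite !mxE eq_sym.
by case: (i == j); rewrite ?mulr1n ?mulr0n ?linear0 ?scaler0.
Qed.

(** A scalar matrix serves as the unit: 1 when [e] is 1, and the quaternion i for skew-Hermitian
    quaternionic matrices. *)
Lemma prolong_scalar_unit (a b : F) : sigma a = e *: a -> sigma b = e *: b ->
  a * b = 1 -> b * a = 1 ->
  forall phi : 'Hom(V, 'End(V)), prolong (@gl_herm R F sigma e n) phi ->
  exists p, forall x, phi x = gl_act (herm_box x p).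
Proof.
move=> sa sb ab ba.
by apply: (@prolong_unit (vsproj H (a%:M : M)) (vsproj H (b%:M : M)));
  rewrite !vsprojK ?scalar_herm // -scalar_mxM ?ab ?ba.
Qed.

(** * The prolongation for alternating matrices, on matrix units *)

Section Alternating.
Hypotheses (mulFC : forall a b : F, a * b = b * a).
Hypotheses (sigma1 : forall a, sigma a = a) (eN1 : e = -1) (n5 : (5 <= n)%N).

(** This is k (E_ab - E_ba). The scalar [k] is carried along because elements of g^(1) are given as
    R-linear maps only. *)
Definition alt_mx (a b : 'I_n) (k : F) : M :=
  \matrix_(i, j) (k *+ ((i == a) && (j == b)) - k *+ ((i == b) && (j == a))).

Definition alt_vec a b k : V := vsproj H (alt_mx a b k).

Lemma alt_vecE a b k : vsval (alt_vec a b k) = alt_mx a b k.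
Proof.
rewrite vsprojK // mem_herm eN1; apply/eqP/matrixP => i j.
by rewrite !mxE sigma1 scaleN1r opprB ![(j == _) && _]andbC.
Qed.

Lemma alt_vecC a b k : alt_vec b a k = - alt_vec a b k.
Proof.
apply: val_inj; rewrite /= !alt_vecE; apply/matrixP => i j.
by rewrite !mxE opprB.
Qed.

Let sum_delta (f : 'I_n -> F) (a : 'I_n) (b : bool) :
  \sum_j f j *+ ((j == a) && b) = f a *+ b.
Proof.
by rewrite (bigD1 a) //= eqxx big1 ?addr0 // => j /negPf ->.
Qed.

Let sum_delta1 (f : 'I_n -> F) (a : 'I_n) : \sum_j f j *+ (j == a) = f a.
Proof. by rewrite (bigD1 a) //= eqxx big1 ?addr0 // => j /negPf ->. Qed.

Lemma alt_vec_sum (x : V) :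
  x *+ 2 = \sum_a \sum_b alt_vec a b ((vsval x : M) a b).
Proof.
rewrite mulr2n; apply: val_inj; rewrite /= raddf_sum /=.
under eq_bigr do rewrite raddf_sum /=.
apply/matrixP => i j; rewrite summxE.
under eq_bigr => a _.
  rewrite summxE; under eq_bigr => b _.
    rewrite alt_vecE mxE (eq_sym i a) (eq_sym i b) (eq_sym j a) (eq_sym j b).
    rewrite [(a == i) && _]andbC.
    over.
  rewrite big_split /= sum_delta sumrN sum_delta.
  over.
rewrite big_split sumrN /= !sum_delta1.
have xs : (vsval x)^s = - vsval x.
  rewrite vsval_herm (congr1 (fun c => c *: (vsval x : M)) eN1).
  exact: (scaleN1r (vsval x : M)).
by move/matrixP/(_ j i): xs; rewrite !mxE sigma1 => ->.
Qed.

(** The bound on [n] enters through this choice of a further index. *)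
Lemma fresh (s : seq 'I_n) : (size s <= 4)%N -> exists d, d \notin s.
Proof.
move=> s4; case: (pickP (fun d => d \notin s)) => [d ds|ns]; first by exists d.
have : (#|'I_n| <= size s)%N.
  by rewrite cardE uniq_leq_size ?enum_uniq // => i _; have /negbFE := ns i.
by rewrite card_ord => /(leq_trans n5); rewrite leqNgt ltnS s4.
Qed.

Lemma alt_mulE (A : M) c d k p q :
  (A *m alt_mx c d k + alt_mx c d k *m A^s) p q =
  (A p c * k *+ (q == d) - A p d * k *+ (q == c)) +
  (A q d * k *+ (p == c) - A q c * k *+ (p == d)).
Proof.
rewrite !mxE; congr (_ + _).
  under eq_bigr do rewrite mxE mulrBr !mulrnAr.
  by rewrite big_split sumrN /= !sum_delta.
under eq_bigr => j _.
  rewrite !mxE sigma1 mulrBl !mulrnAl mulFC.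
  rewrite [(p == c) && _]andbC [(p == d) && _]andbC.
  over.
by rewrite big_split sumrN /= !(sum_delta (fun j => A q j * k)).
Qed.

Let double0 (a : F) : a + a = 0 -> a = 0.
Proof.
move/eqP; rewrite -mulr2n -scaler_nat scaler_eq0 pnatr_eq0 /=.
by move/eqP.
Qed.

(** Makes the matrix representing phi(x) unique, so that one picked by choice is odd in x.
    Off-diagonal entries vanish by testing on one matrix unit; diagonal ones are pairwise opposite,
    and three indices force them to vanish. *)
Lemma gl_act_inj : injective gl_act.
Proof.
suff A0 A : gl_act A = 0 -> A = 0.
  move=> A B AB; apply/eqP; rewrite -subr_eq0; apply/eqP/A0.
  by rewrite (zmod_morphism_linear gl_act_linear) AB subrr.
move=> actA.
have E c d p q : (A p c *+ (q == d) - A p d *+ (q == c)) +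
    (A q d *+ (p == c) - A q c *+ (p == d)) = 0.
  have := alt_mulE A c d 1 p q; rewrite !mulr1 => <-.
  by rewrite -alt_vecE -gl_actE actA lfunE /= mxE.
have diag c d : c != d -> A c c = - A d d.
  move=> cd; have := E c d c d; rewrite !eqxx; neqs; simp_deltas.
  by move/eqP; rewrite addr_eq0 => /eqP.
apply/matrixP => p c; rewrite mxE.
have [d /[!inE]/[!negb_or]/andP[dp dc]] := fresh (s := [:: p; c]) isT.
have [<-{c dc}|pc] := eqVneq p c; last first.
  by have := E c d p d; rewrite !eqxx; neqs; simp_deltas.
have [f /[!inE]/[!negb_or]/andP[fp fd]] := fresh (s := [:: p; d]) isT.
apply: double0; rewrite {1}(diag p d) 1?eq_sym //.
by rewrite (diag d f) 1?eq_sym // opprK (diag p f) 1?eq_sym // addrN.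
Qed.

(** Real or complex alternating matrices of odd size are singular, so no unit is available. Instead
    A x = x P is proved for one alternating P: in [A (alt_vec a b k)], row a is k times row b of P,
    row b is minus k times row a of P, and all other rows vanish. *)
Lemma prolong_alt (phi : 'Hom(V, 'End(V))) :
  prolong (@gl_herm R F sigma e n) phi ->
  exists p, forall x, phi x = gl_act (herm_box x p).
Proof.
move=> [phig phiC].
have [A phiA] := choice (fun x => (gl_hermP (phi x)).1 (phig x)).
have AN x : A (- x) = - A x.
  have actB := zmod_morphism_linear gl_act_linear.
  have act0 : gl_act 0 = 0 by rewrite -(subrr 0) actB subrr.
  have phiN : phi (- x) = - phi x by rewrite linearN.
  by apply: gl_act_inj; rewrite -phiA phiN phiA -[- A x]sub0r actB act0 sub0r.
pose al a b k (p q : 'I_n) : F := (A (alt_vec a b k) : M) p q.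
have alC a b k p q : al b a k p q = - al a b k p q.
  by rewrite /al alt_vecC AN mxE.
(* Entry (p, q) of phi(x) y = phi(y) x for x = k (E_ab - E_ba) and y = E_cd - E_dc. *)
have E a b k c d p q :
    (al a b k p c *+ (q == d) - al a b k p d *+ (q == c)) +
    (al a b k q d *+ (p == c) - al a b k q c *+ (p == d)) =
    (al c d 1 p a * k *+ (q == b) - al c d 1 p b * k *+ (q == a)) +
    (al c d 1 q b * k *+ (p == a) - al c d 1 q a * k *+ (p == b)).
  have := alt_mulE (A (alt_vec a b k)) c d 1 p q; rewrite !mulr1 => <-.
  have := alt_mulE (A (alt_vec c d 1)) a b k p q => <-.
  by rewrite -!alt_vecE -!gl_actE -!phiA phiC.
(* The right side does not involve a; this independence makes P well defined. *)
have cross a b c d k : uniq [:: a; b; c; d] -> al a b k a c = al c d 1 d b * k.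
  by distinct; have := E a b k c d a d; rewrite !eqxx; neqs; simp_deltas.
have off a b k p c : uniq [:: a; b; p; c] -> al a b k p c = 0.
  distinct; have [d] := fresh (s := [:: a; b; p; c]) isT; distinct.
  by have := E a b k c d p d; rewrite !eqxx; neqs; simp_deltas.
have diagN a b k c d : uniq [:: a; b; c; d] -> al a b k c c = - al a b k d d.
  distinct; have := E a b k c d c d; rewrite !eqxx; neqs; simp_deltas.
  by move/eqP; rewrite addr_eq0 => /eqP.
(* Diagonal entries outside a and b are pairwise opposite; three such indices, five in all, force
   them to vanish. *)
have diag a b k c : uniq [:: a; b; c] -> al a b k c c = 0.
  distinct; have [d] := fresh (s := [:: a; b; c]) isT; distinct.
  have [f] := fresh (s := [:: a; b; c; d]) isT; distinct.
  apply: double0; rewrite {1}(diagN a b k c d); last by rewrite /= !inE; neqs.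
  rewrite (diagN a b k d f) ?opprK; last by rewrite /= !inE; neqs.
  by rewrite (diagN a b k c f) ?addrN //= !inE; neqs.
have low a b k p : uniq [:: a; b; p] -> al a b k p a = 0.
  distinct; have [d] := fresh (s := [:: a; b; p]) isT; distinct.
  by have := E a b k a d p d; rewrite !eqxx; neqs; simp_deltas.
have lowb a b k d : uniq [:: a; b; d] -> al a b k b a = - (al a d 1 d a * k).
  by distinct; have := E a b k a d b d; rewrite !eqxx; neqs; simp_deltas.
(* By [lowb], entry (b, a) for k = 1 changes sign whenever b is replaced by another index; going
   round three indices gives the negative of the initial value. *)
have low0 a b k : a != b -> al a b k b a = 0.
  distinct; have [d] := fresh (s := [:: a; b]) isT; distinct.
  have [f] := fresh (s := [:: a; b; d]) isT; distinct.
  rewrite (lowb a b k d); last by rewrite /= !inE; neqs.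
  suff -> : al a d 1 d a = 0 by rewrite mul0r oppr0.
  apply: double0; rewrite {1}(lowb a d 1 f); last by rewrite /= !inE; neqs.
  rewrite (lowb a f 1 b); last by rewrite /= !inE; neqs.
  rewrite (lowb a b 1 d); last by rewrite /= !inE; neqs.
  by rewrite !mulr1 !opprK addNr.
have top a b k d : uniq [:: a; b; d] ->
    al a b k a a = - (al a b k d d) + al a d 1 d b * k.
  distinct; have := E a b k a d a d; rewrite !eqxx; neqs; simp_deltas.
  by move=> <-; rewrite addrC addrK.
have [f fP] : exists f : 'I_n -> 'I_n -> 'I_n,
    forall b c, f b c \notin [:: b; c].
  have /choice[f fP] : forall bc : 'I_n * 'I_n,
      exists a, a \notin [:: bc.1; bc.2].
    by move=> bc; apply: fresh.
  by exists (fun b c => f (b, c)) => b c; have := fP (b, c).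
(* Any index outside b and c could replace [f b c], by [cross]; the boolean factor sets the diagonal
   to 0. *)
pose P : M := \matrix_(b, c) (al (f b c) b 1 (f b c) c *+ (b != c)).
have PE a b c k : uniq [:: a; b; c] -> al a b k a c = P b c * k.
  distinct; have := fP b c; distinct.
  have [d] := fresh (s := [:: a; f b c; b; c]) isT; distinct.
  rewrite mxE; neqs; simp_deltas.
  rewrite (cross a b c d); last by rewrite /= !inE; neqs.
  by rewrite (cross (f b c) b c d) ?mulr1 //= !inE; neqs.
have PN b c : P b c = - P c b.
  have [<-|] := eqVneq b c; first by rewrite mxE eqxx oppr0.
  distinct; have [a] := fresh (s := [:: b; c]) isT; distinct.
  have [d] := fresh (s := [:: a; b; c]) isT; distinct.
  rewrite -[P b c]mulr1 -(PE a); last by rewrite /= !inE; neqs.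
  rewrite (cross a b c d); last by rewrite /= !inE; neqs.
  by rewrite alC mulr1 (PE d) ?mulr1 //= !inE; neqs.
have altPE a b k p q : (alt_mx a b k *m P) p q =
    P b q * k *+ (p == a) - P a q * k *+ (p == b).
  rewrite mxE; under eq_bigr => j _.
    rewrite [alt_mx _ _ _ _ _]mxE mulrBl !mulrnAl mulFC.
    rewrite [(p == a) && _]andbC [(p == b) && _]andbC.
    over.
  by rewrite big_split sumrN /= !(sum_delta (fun j => P j q * k)).
have P0 b : P b b = 0 by rewrite mxE eqxx.
(* Column b is left out: it follows afterwards by exchanging a and b. *)
have colE a b k p q : a != b -> q != b ->
    al a b k p q = (alt_mx a b k *m P) p q.
  move=> ab qb; rewrite altPE; have [->{q qb}|qa] := eqVneq q a.
    rewrite P0 mul0r mul0rn subr0; have [->{p}|pa] := eqVneq p a.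
      have [d] := fresh (s := [:: a; b]) isT; distinct.
      rewrite (top a b k d); last by rewrite /= !inE; neqs.
      rewrite (diag a b k d) ?oppr0 ?add0r; last by rewrite /= !inE; neqs.
      by rewrite alC (PE d) ?mulr1 ?[P b a]PN //= !inE; neqs.
    have [->{p pa}|pb] := eqVneq p b; first by rewrite low0.
    by rewrite low //= !inE; neqs.
  have [->{p}|pa] := eqVneq p a.
    by neqs; simp_deltas; rewrite PE //= !inE; neqs.
  have [->{p pa}|pb] := eqVneq p b.
    by simp_deltas; rewrite alC PE //= !inE; neqs.
  simp_deltas; have [->|pq] := eqVneq p q; first by rewrite diag //= !inE; neqs.
  by rewrite off //= !inE; neqs.
have AE a b k : A (alt_vec a b k) = alt_mx a b k *m P.
  have [->{a}|ab] := eqVneq a b.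
    have -> : alt_vec b b k = 0.
      apply: val_inj; rewrite /= alt_vecE; apply/matrixP => i j.
      by rewrite !mxE subrr.
    have -> : alt_mx b b k = 0 by apply/matrixP => i j; rewrite !mxE subrr.
    (* [A] comes from choice, so [A 0] = 0 is deduced from its oddness. *)
    by rewrite mul0mx; have := AN 0; rewrite oppr0 => A0; apply/matrixP => i j;
      rewrite mxE; apply: double0; rewrite {1}A0 mxE addNr.
  apply/matrixP => p q; have [->{q}|] := eqVneq q b; last exact: colE.
  by rewrite -/(al a b k p b) alC colE 1?eq_sym // !altPE opprB.
have PH : (P : M)^H \in H.
  apply: herm_conj; rewrite mem_herm; apply/eqP.
  rewrite (congr1 (fun c => c *: P) eN1) scaleN1r.
  by apply/matrixP => i j; rewrite [LHS]mxE [LHS]mxE sigma1 PN [RHS]mxE.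
exists (vsproj H P^H) => x; apply/eqP; rewrite -subr_eq0.
pose psi x := phi x - gl_act (herm_box x (vsproj H P^H)).
have psil : linear psi.
  move=> a y z; rewrite /psi linearP herm_box_linl gl_act_linear.
  by rewrite scalerBr opprD addrACA.
have psi0 a b k : psi (alt_vec a b k) = 0.
  by rewrite /psi phiA AE /herm_box vsprojK // cKm alt_vecE subrr.
have : psi x *+ 2 = 0.
  have psiE := lin_fun_homE psil.
  rewrite -!psiE -linearMn alt_vec_sum linear_sum big1 // => a _.
  by rewrite linear_sum big1 // => b _; rewrite /= psiE psi0.
by rewrite -scaler_nat => /eqP; rewrite scaler_eq0 pnatr_eq0.
Qed.

End Alternating.

Lemma herm_set_bij :
  (forall phi : 'Hom(V, 'End(V)), prolong (@gl_herm R F sigma e n) phi ->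
    exists p, forall x, phi x = gl_act (herm_box x p)) ->
  set_bij (im_antisym2 (@gl_herm R F sigma e n))
    (ric_space (@gl_herm R F sigma e n))
    (@ric R V : {linear tens2 V 'End(V) -> tens2 V R^o}).
Proof.
move=> prolongP.
(* The form on matrices is doubled to absorb the factor 2 of [mxip_box]. *)
apply: (@ric_set_bij R V M (fun S T => mxip conj re (vsval S) (vsval T))
  (fun A B => mxip conj re A B *+ 2) gl_act herm_box) => //.
- have [l c p] := mx_inner_product cF n n.
  by split=> [T a S U|S T|S S0]; rewrite /= ?l ?p.
- have [l c p] := mx_inner_product cF n n.
  split=> [T a S U|S T|S S0]; last by rewrite pmulrn_lgt0 ?p.
    by rewrite l mulrnDl mulrnAr.
  by rewrite c.
- exact: gl_act_linear.
- exact: herm_box_linl.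
- exact: herm_box_linr.
- exact: gl_act_box_sym.
- by move=> x p a; rewrite mxip_box.
- exact: gl_hermP.
Qed.

Lemma herm_unit_set_bij (a b : F) : sigma a = e *: a -> sigma b = e *: b ->
  a * b = 1 -> b * a = 1 ->
  set_bij (im_antisym2 (@gl_herm R F sigma e n))
    (ric_space (@gl_herm R F sigma e n))
    (@ric R V : {linear tens2 V 'End(V) -> tens2 V R^o}).
Proof. by move=> *; apply/herm_set_bij/(@prolong_scalar_unit a b). Qed.

Lemma herm_alt_set_bij : (forall a b : F, a * b = b * a) ->
  (forall a, sigma a = a) -> e = -1 -> (5 <= n)%N ->
  set_bij (im_antisym2 (@gl_herm R F sigma e n))
    (ric_space (@gl_herm R F sigma e n))
    (@ric R V : {linear tens2 V 'End(V) -> tens2 V R^o}).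
Proof. by move=> *; apply/herm_set_bij/prolong_alt. Qed.

End HermitianAction.

Lemma ord_other n : (2 <= n)%N -> exists f : 'I_n -> 'I_n, forall k, f k != k.
Proof.
case: n => [|[|n]] // _.
exists (fun k => if k == ord0 then lift ord0 ord0 else ord0).
by move=> k; case: (eqVneq k ord0) => [->|]; rewrite 1?eq_sym.
Qed.

(** * Rectangular matrices under left and right multiplication *)

Section TensorAction.
Variables (R : rcfType) (F : falgType R) (conj : F -> F) (re : F -> R).
Hypothesis cF : conj_algebra conj re.
Variables (m r : nat).

Local Notation V := (resmx F m r).
Local Notation Vm := ('M[F]_(m, r)).
Local Notation "A ^H" := (adjmx conj A) (at level 8, format "A ^H").

(** The pair (c, -c) of a central scalar acts by zero, so pairs parametrise g redundantly;
    [tensor_algP] relates them to the algebra with trace conditions. *)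
Definition pair_act_fun (AB : resmx F m m * resmx F r r) (X : V) : V :=
  AB.1 *m X + X *m AB.2.

Lemma pair_act_fun_linear AB : linear (pair_act_fun AB).
Proof.
move=> a X Y; rewrite /pair_act_fun mulmxDr mulmxDl.
by rewrite resmx_mulscale resmx_scalemul addrACA -resmx_scaleDr.
Qed.

Definition pair_act AB : 'End(V) := linfun (pair_act_fun AB).

Lemma pair_actE AB X : pair_act AB X = AB.1 *m X + X *m AB.2 :> Vm.
Proof. by rewrite (lin_fun_homE (pair_act_fun_linear AB)). Qed.

Lemma pair_act_linear : linear pair_act.
Proof.
move=> a AB CD; apply/lfunP => X; rewrite add_lfunE scale_lfunE !pair_actE /=.
rewrite mulmxDl mulmxDr resmx_mulscale resmx_scalemul.
by rewrite addrACA -resmx_scaleDr.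
Qed.

Definition tensor_box (X P : V) : resmx F m m * resmx F r r :=
  (X *m P^H, P^H *m X).

Lemma pair_act_box X P Y :
  pair_act (tensor_box X P) Y = X *m P^H *m Y + Y *m P^H *m X :> Vm.
Proof. by rewrite pair_actE mulmxA. Qed.

Lemma tensor_box_linl P : linear (tensor_box^~ P).
Proof.
move=> a X Y; rewrite /tensor_box mulmxDl mulmxDr.
by rewrite resmx_mulscale resmx_scalemul.
Qed.

Lemma tensor_box_linr X : linear (tensor_box X).
Proof.
move=> a P Q; rewrite /tensor_box (adjmxD (conjD cF)).
rewrite (resmx_adjscale _ _ (conjZ cF)).
by rewrite mulmxDl mulmxDr resmx_mulscale resmx_scalemul.
Qed.

Lemma pair_act_box_sym X P Y :
  pair_act (tensor_box X P) Y = pair_act (tensor_box Y P) X.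
Proof. by rewrite !pair_act_box addrC. Qed.

Definition pair_ip (AB CD : resmx F m m * resmx F r r) : R :=
  mxip conj re AB.1 CD.1 + mxip conj re AB.2 CD.2.

Lemma pair_inner_product : inner_product pair_ip.
Proof.
have [l1 c1 p1] := mx_inner_product cF m m.
have [l2 c2 p2] := mx_inner_product cF r r.
split=> [CD a AB AB'|AB CD|[A B] AB0]; rewrite /pair_ip /=.
- by rewrite l1 l2 mulrDr addrACA.
- by rewrite c1 c2.
- have := ip_ge0 (mx_inner_product cF m m) A.
  have := ip_ge0 (mx_inner_product cF r r) B.
  have [A0|A0] := eqVneq A 0; last by move=> *; rewrite ltr_wpDr ?p1.
  have [B0|B0] := eqVneq B 0; last by move=> *; rewrite ltr_wpDl ?p2.
  by rewrite A0 B0 eqxx in AB0.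
Qed.

(** No factor 2 appears here: left and right multiplication have separate components, each giving
    one term of the action. *)
Lemma pair_ip_box X P AB :
  pair_ip (tensor_box X P) AB = mxip conj re X (pair_act AB P).
Proof.
rewrite /pair_ip /mxip pair_actE mulmxDr (retrD cF) /=.
rewrite !(adjmxM (conjD cF) (conjM cF)) !(adjmxK (conjK cF)).
by rewrite -!mulmxA (retrC cF) -!mulmxA.
Qed.

Variable g : set 'End(V).
Hypothesis gP : forall f, g f <-> exists AB, f = pair_act AB.

Lemma tensor_set_bij :
  (forall phi : 'Hom(V, 'End(V)), prolong g phi ->
    exists p, forall x, phi x = pair_act (tensor_box x p)) ->
  set_bij (im_antisym2 g) (ric_space g)
    (@ric R V : {linear tens2 V 'End(V) -> tens2 V R^o}).
Proof.
move=> prolongP.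
apply: (@ric_set_bij R V _ (@mxip _ _ conj re m r) pair_ip pair_act
  tensor_box) => //.
- exact: mx_inner_product.
- exact: pair_inner_product.
- exact: pair_act_linear.
- exact: tensor_box_linl.
- exact: tensor_box_linr.
- exact: pair_act_box_sym.
- by move=> x p a; rewrite pair_ip_box.
Qed.

Definition rank1_mx (i : 'I_m) (j : 'I_r) (a : F) : V :=
  \matrix_(p, q) (a *+ ((p == i) && (q == j))).

Lemma rank1_mx_sum (X : V) : X = \sum_i \sum_j rank1_mx i j (X i j).
Proof.
apply/matrixP => p q; rewrite summxE (bigD1 p) //= summxE (bigD1 q) //=.
rewrite mxE !eqxx !big1 ?addr0 // => [i pi|j qj]; last first.
  by rewrite mxE eqxx (eq_sym q) (negPf qj).
by rewrite summxE big1 // => j _; rewrite mxE eq_sym (negPf pi).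
Qed.

Lemma rank1_actE (A : 'M[F]_m) (B : 'M[F]_r) k l b p q :
  (A *m rank1_mx k l b + rank1_mx k l b *m B) p q =
  A p k * b *+ (q == l) + b * B l q *+ (p == k).
Proof.
rewrite !mxE; congr (_ + _).
  rewrite (bigD1 k) //= mxE eqxx big1 ?addr0 ?mulrnAr // => j /negPf jk.
  by rewrite mxE jk mulr0.
rewrite (bigD1 l) //= mxE eqxx andbT big1 ?addr0 ?mulrnAl // => j /negPf jk.
by rewrite mxE jk andbF mul0r.
Qed.

(** * Vanishing of a normalised element of the prolongation *)

Section Prolongation.
Variable phi : 'Hom(V, 'End(V)).
Hypothesis phiP : prolong g phi.
Variables (fi : 'I_m -> 'I_m) (A : V -> 'M[F]_m) (B : V -> 'M[F]_r).
Hypotheses (fiP : forall k, fi k != k).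
Hypothesis phiE : forall X Y, phi X Y = A X *m Y + Y *m B X :> Vm.

Let al i j a p q := A (rank1_mx i j a) p q.
Let be i j a p q := B (rank1_mx i j a) p q.

Hypothesis al0 : forall j k, al (fi k) j 1 (fi k) k = 0.

Let phi_rank1 i j a k l b p q :
  (phi (rank1_mx i j a) (rank1_mx k l b) : Vm) p q =
  al i j a p k * b *+ (q == l) + b * be i j a l q *+ (p == k).
Proof. by rewrite phiE rank1_actE. Qed.

Let E i j a k l b p q :
  al i j a p k * b *+ (q == l) + b * be i j a l q *+ (p == k) =
  al k l b p i * a *+ (q == j) + a * be k l b j q *+ (p == i).
Proof. by rewrite -!phi_rank1 phiP.2. Qed.

Lemma rank1_eq0 : (forall i j a k l b p q,
    al i j a p k * b *+ (q == l) + b * be i j a l q *+ (p == k) = 0) ->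
  phi = 0.
Proof.
move=> phi0; apply/lfunP => X; apply/lfunP => Y; rewrite !lfunE /=.
rewrite [Y]rank1_mx_sum linear_sum big1 // => k _.
rewrite linear_sum big1 // => l _ /=.
rewrite phiP.2 [X]rank1_mx_sum linear_sum big1 // => i _.
rewrite linear_sum big1 // => j _ /=.
by apply/matrixP => p q; rewrite phi_rank1 phi0 mxE.
Qed.

(** [al0] and the symmetry [E] kill the off-diagonal entries of [A] and [B]. Diagonal entries need
    only cancel each other, since a scalar in [A] can be compensated in [B]. *)
Lemma prolong_eq0_ge2 (fj : 'I_r -> 'I_r) : (forall j, fj j != j) -> phi = 0.
Proof.
move=> fjP; apply: rank1_eq0.
have T1 k l b j : j != l -> be k l b j l = 0.
  move=> jl; have fik := fiP k; have := E (fi k) j 1 k l b (fi k) l.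
  by rewrite !eqxx al0; neqs; rewrite mul0r mul1r; simp_deltas.
have T2 i j a k : k != i -> al i j a i k = 0.
  move=> ki; have fj1 := fjP j; have := E i j a k (fj j) 1 i (fj j).
  by rewrite !eqxx T1 1?eq_sym //; neqs; rewrite mulr1 mulr0; simp_deltas.
have T3 i j a p k : p != i -> p != k -> al i j a p k = 0.
  move=> pi pk; have fj1 := fjP j; have := E i j a k (fj j) 1 p (fj j).
  by rewrite !eqxx; neqs; rewrite mulr1; simp_deltas.
have aoff i j a p k : p != k -> al i j a p k = 0.
  have [->|] := eqVneq p i; last exact: T3.
  by rewrite eq_sym; exact: T2.
have boff i j a l q : l != q -> be i j a l q = 0.
  move=> lq; have [qj|qj] := eqVneq q j; first by subst q; exact: T1.
  have fi1 := fiP i; have := E i j a (fi i) l 1 (fi i) q.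
  by rewrite !eqxx; neqs; rewrite mul1r; simp_deltas.
have D1 i j a k l b : k != i -> l != j ->
    al i j a k k * b + b * be i j a l l = 0.
  move=> ki lj; have := E i j a k l b k l.
  by rewrite !eqxx; neqs; simp_deltas.
have D2 i j a l b : l != j -> al i j a i i * b + b * be i j a l l = 0.
  move=> lj; have := E i j a i l b i l.
  rewrite !eqxx [be _ _ _ j l]boff 1?eq_sym //; neqs.
  by rewrite mulr0; simp_deltas.
have D3 i j a k b : k != i -> al i j a k k * b + b * be i j a j j = 0.
  move=> ki; have := E i j a k j b k j.
  by rewrite !eqxx [al _ _ _ k i]aoff //; neqs; rewrite mul0r; simp_deltas.
have D i j a k l b : al i j a k k * b + b * be i j a l l = 0.
  have [->|ki] := eqVneq k i; have [->|lj] := eqVneq l j.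
  (* [be] at (j, j) and at (fj j, fj j) cancel the same [al] term, so the former may be traded for
     the latter, where [D2] applies. *)
  - have /addrI -> := etrans (D3 i j a (fi i) b (fiP i))
      (esym (D1 i j a (fi i) (fj j) b (fiP i) (fjP j))).
    exact/D2/fjP.
  - exact: D2.
  - exact: D3.
  - exact: D1.
move=> i j a k l b p q; have [->|ql] := eqVneq q l; have [->|pk] := eqVneq p k.
- exact: D.
- by rewrite aoff // mul0r add0r.
- by rewrite boff 1?eq_sym // mulr0 addr0.
- by rewrite addr0.
Qed.

(* First B is shown to be central-valued; then (X, Y) |-> phi X Y is symmetric
   and right F-bilinear on F^m, so it vanishes as F is not commutative. *)
Lemma prolong_eq0_noncomm (u v : F) :
  (forall c, c * (u * v - v * u) = 0 -> c = 0) ->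
  (forall j l : 'I_r, j = l) -> phi = 0.
Proof.
move=> uv r1; apply: rank1_eq0.
(* Both f and h are left multiplication by one c, and c a b = c b a for all a, b gives c (u v - v u)
   = 0. *)
have fg_eq0 (f h : F -> F) :
    (forall a b, f a * b = h b * a) -> forall a, f a = 0.
  move=> fh; have f1 a : f a = h 1 * a by rewrite -fh mulr1.
  have h1 b : h b = f 1 * b by rewrite fh mulr1.
  have hc : h 1 = f 1 by rewrite h1 mulr1.
  have c0 : h 1 = 0.
    by apply: uv; rewrite mulrBr !mulrA -!f1 fh h1 -hc -!f1 fh h1 -hc subrr.
  by move=> a; rewrite f1 c0 mul0r.
have E1 o i a k b p : al i o a p k * b + b * be i o a o o *+ (p == k) =
    al k o b p i * a + a * be k o b o o *+ (p == i).
  by have := E i o a k o b p o; rewrite !eqxx.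
have bC o k b c : be k o b o o * c = c * be k o b o o.
  pose i := fi k; pose bt b' := be k o b' o o.
  have ki : i != k := fiP k.
  have aE a b' : al i o a i k * b' = al k o b' i i * a + a * bt b'.
    by have := E1 o i a k b' i; rewrite eqxx (negPf ki); simp_deltas.
  have btE b' : al k o b' i i = - bt b'.
    have := aE 1 b'; rewrite al0 mul0r mulr1 mul1r => /esym/eqP.
    by rewrite addr_eq0 => /eqP.
  have {aE} aE a b' : al i o a i k * b' = a * bt b' - bt b' * a.
    by rewrite aE btE mulNr addrC.
  pose C a := a * bt 1 - bt 1 * a.
  have CE a b' : C a * b' = a * bt b' - bt b' * a by rewrite /C -aE mulr1 aE.
  (* Expand C(a u) v by the Leibniz rule, once for the commutator with bt 1 and once, through [CE],
     for that with bt v: this gives C(a) u v = C(a) v u. *)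
  have C0 a : C a = 0.
    apply: uv; rewrite mulrBr; apply/eqP; rewrite subr_eq0; apply/eqP.
    apply: (addrI (a * (C u * v))).
    transitivity (C (a * u) * v).
      rewrite mulrA [C a * _]mulrA -mulrDl; congr (_ * _).
      by rewrite /C mulrBr mulrBl !mulrA subrKA.
    by rewrite [C a * _]mulrA !CE mulrBr mulrBl !mulrA subrKA.
  by apply/eqP; rewrite -subr_eq0 -opprB -CE C0 mul0r oppr0.
move=> i j a k l b p q; rewrite (r1 l j) (r1 q j) eqxx.
pose f a := al i j a p k + be i j a j j *+ (p == k).
have fE a' b' : al i j a' p k * b' + b' * be i j a' j j *+ (p == k) = f a' * b'.
  by rewrite /f mulrDl mulrnAl bC.
rewrite fE (@fg_eq0 f (fun b => al k j b p i + be k j b j j *+ (p == i)));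
  first by rewrite mul0r.
by move=> a' b'; rewrite -fE E1 /= mulrDl mulrnAl bC.
Qed.

End Prolongation.
(** With a single column over R or C, g would be all of gl(m, F) on F^m, whose prolongation is
    larger than V^*; hence the alternative of two columns or noncommuting scalars. *)
Lemma tensor_prolong : (2 <= m)%N -> (0 < r)%N ->
  (2 <= r)%N \/ (exists u v : F, forall c, c * (u * v - v * u) = 0 -> c = 0) ->
  forall phi : 'Hom(V, 'End(V)), prolong g phi ->
  exists p, forall x, phi x = pair_act (tensor_box x p).
Proof.
move=> m2 r0 r2 phi phiP; have [fi fiP] := ord_other m2.
pose l0 := Ordinal r0.
(* For X = E_(fi k, j), entry (fi k, k) of X P is made equal to that of the left matrix of phi(X),
   which yields [al0] after subtraction. Since fi k differs from k, the right matrix does not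
   contribute to the entry read off. *)
pose P : resmx F r m := \matrix_(j, k)
  (phi (rank1_mx (fi k) j 1) (rank1_mx k l0 1) : Vm) (fi k) l0.
have [psi psiP psiE] := prolong_sub pair_act_linear tensor_box_linl
  pair_act_box_sym gP (P^H : V) phiP.
exists P^H => x; apply/eqP; rewrite -subr_eq0 -psiE.
suff -> : psi = 0 by rewrite lfunE.
have [AB psiAB] := choice (fun x => (gP (psi x)).1 (psiP.1 x)).
have psiM X Y : psi X Y = (AB X).1 *m Y + Y *m (AB X).2 :> Vm.
  by rewrite psiAB pair_actE.
have AB0 j k : (AB (rank1_mx (fi k) j 1)).1 (fi k) k = 0.
  have := psiM (rank1_mx (fi k) j 1) (rank1_mx k l0 1).
  move=> /matrixP/(_ (fi k) l0); rewrite rank1_actE eqxx (negPf (fiP k)).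
  rewrite mulr0n addr0 mulr1n mulr1 => <-.
  rewrite psiE add_lfunE opp_lfunE mxE [X in _ + X]mxE pair_act_box.
  rewrite (adjmxK (conjK cF)) -(mulmxA (rank1_mx k l0 1) P) rank1_actE.
  rewrite eqxx (negPf (fiP k)) mulr0n addr0 mulr1n mulr1 mxE (bigD1 j) //= mxE.
  rewrite !eqxx mul1r big1 => [|j' /negPf jj']; last first.
    by rewrite mxE jj' andbF mul0r.
  by rewrite addr0 mxE subrr.
have [r1|] := ltnP 1 r.
  have [fj fjP] := ord_other r1.
  exact: (prolong_eq0_ge2 psiP fiP psiM AB0 fjP).
case: r2 => [r2|[u [v uv]] r1]; first by rewrite leqNgt r2.
apply: (prolong_eq0_noncomm psiP fiP psiM AB0 uv) => j l; apply: val_inj => /=.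
have lt1 (k : 'I_r) : k = 0%N :> nat.
  by apply/eqP; rewrite -leqn0 -ltnS (leq_trans (ltn_ord k)).
by rewrite !lt1.
Qed.

End TensorAction.

(** [theta] projects F to its central scalars: the identity for R and C, the real part for H.
    Subtracting from A and B their scalar parts, read off from the trace, leaves elements of [sl1]
    and [sl2]; being central, both scalars merge into one. *)
Lemma tensor_algP (R : rcfType) (F : falgType R) (sigma theta : {linear F -> F})
    (m r : nat) (Z : set F) (sl1 : set 'M[F]_m) (sl2 : set 'M[F]_r) :
  (0 < m)%N -> (0 < r)%N -> involutive sigma ->
  (forall a b, theta a * b = b * theta a) ->
  (forall a, theta (theta a) = theta a) ->
  (forall a, theta (sigma a) = theta a) ->
  (forall a, Z (theta a)) ->
  (forall A, theta (\tr A) = 0 -> sl1 A) ->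
  (forall A, theta (\tr A) = 0 -> sl2 A) ->
  forall f, tensor_alg sigma Z sl1 sl2 f <-> exists AB, f = pair_act AB.
Proof.
move=> m0 r0 sK tC tt ts Zt sl1t sl2t f; split.
  move=> [c [A [B [_ _ _ fE]]]].
  exists (c%:M + A, adjmx sigma B); apply/lfunP => X.
  by rewrite pair_actE fE /= mulmxDl mul_scalar_mx.
move=> [[A B] ->]; pose a := theta (m%:R^-1 *: \tr A).
pose b := theta (r%:R^-1 *: \tr B).
have traceless n (C : 'M[F]_n) : (0 < n)%N ->
    theta (\tr (C - (theta (n%:R^-1 *: \tr C))%:M)) = 0.
  move=> n0; rewrite raddfB /= mxtrace_scalar linearB linearMn /= tt linearZ /=.
  by rewrite -scaler_nat scalerA divff ?scale1r ?subrr // pnatr_eq0 -lt0n.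
exists (a + b), (A - a%:M), (adjmx sigma (B - b%:M)); split.
- by rewrite /a /b -linearD; apply: Zt.
- by apply: sl1t; apply: traceless.
- have trs (C : 'M[F]_r) : theta (\tr (adjmx sigma C)) = theta (\tr C).
    by rewrite /mxtrace !linear_sum; apply: eq_bigr => i _; rewrite !mxE ts.
  by apply: sl2t; rewrite trs; apply: traceless.
- move=> X; rewrite pair_actE (adjmxK sK) /=.
  have Xb : X *m b%:M = b *: (X : 'M[F]_(m, r)).
    rewrite -diag_const_mx mul_mx_diag; apply/matrixP => i j.
    by rewrite !mxE -tC.
  rewrite mulmxBl mulmxBr mul_scalar_mx Xb scalerDl.
  by rewrite [a *: _ + _ + _]addrC !addrA subrK [A *m X + _ + _]addrAC addrK.
Qed.

(** * The scalars R, C and H *)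

Lemma real_conj_algebra (R : realFieldType) :
  conj_algebra (idfun : R^o -> R^o) (idfun : R^o -> R).
Proof.
split.
- by move=> a x y.
- by move=> a b; exact: mulrC.
- by move=> a.
- by move=> a x y.
- by move=> a b; exact: (mulrC (a : R)).
- by move=> a.
- by move=> a a0; rewrite /= -[_ * _]expr2 exprn_even_gt0.
Qed.

Lemma complex_conj_algebra (R : rcfType) :
  conj_algebra (@Rconjc R) (@complex.Re R : Rcomplex R -> R).
Proof.
split.
- exact: Rconjc_is_linear.
- by move=> [a b] [c d]; congr Complex => /=; ring.
- by move=> [a b]; rewrite /Rconjc /= opprK.
- by move=> c [a b] [x y].
- by move=> [a b] [x y] /=; ring.
- by move=> [].
- move=> [a b] ab0 /=; rewrite mulNr opprK.
  rewrite lt_neqAle addr_ge0 -?expr2 ?sqr_ge0 // andbT eq_sym.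
  rewrite paddr_eq0 ?sqr_ge0 // !sqrf_eq0; apply: contra ab0.
  by move=> /andP[/eqP -> /eqP ->].
Qed.

Lemma quat_conj_algebra (R : realFieldType) :
  conj_algebra (@conjq R) (@qre R).
Proof.
split.
- exact: conjq_is_linear.
- by move=> [a b c d] [x y z t]; congr Quat => /=; ring.
- by move=> [a b c d]; rewrite /conjq /= !opprK.
- by move=> c [a1 a2 a3 a4] [x y z t].
- by move=> [a b c d] [x y z t] /=; ring.
- by move=> [].
- move=> [a b c d] q0 /=.
  have -> : a * a - - b * b - - c * c - - d * d =
      a ^+ 2 + b ^+ 2 + c ^+ 2 + d ^+ 2 by ring.
  rewrite lt_neqAle !addr_ge0 ?sqr_ge0 // andbT eq_sym.
  rewrite !paddr_eq0 ?addr_ge0 ?sqr_ge0 // !sqrf_eq0; apply: contra q0.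
  by move=> /andP[/andP[/andP[/eqP -> /eqP ->] /eqP ->] /eqP ->].
Qed.

(* The projection of H onto its real scalars, so that slH is the kernel of
   qreal composed with the trace. *)
Definition qreal (R : fieldType) (x : quat R) : quat R := (qre x)%:A.

Fact qreal_is_linear (R : fieldType) : linear (@qreal R).
Proof. by move=> a x y; rewrite /qreal /= scalerDl scalerA. Qed.

HB.instance Definition _ (R : fieldType) :=
  GRing.isLinear.Build R (quat R) (quat R) _ (@qreal R) (@qreal_is_linear R).

(** * The ten cases *)

Section SplitCases.
Variable R : realType.

Definition ricci_bij (V : vectType R) (g : set 'End(V)) :=
  set_bij (im_antisym2 g) (ric_space g)
    (@ric R V : {linear tens2 V 'End(V) -> tens2 V R^o}).

Lemma SymR_bij n : ricci_bij (@gl_herm R R^o idfun 1 n).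
Proof.
apply: (@herm_unit_set_bij R R^o _ _ (real_conj_algebra R) idfun 1 n
  _ _ _ _ _ 1 1); rewrite ?mulr1 ?scale1r //.
by move=> a b; exact: mulrC.
Qed.

Lemma AltR_bij n : (5 <= n)%N -> ricci_bij (@gl_herm R R^o idfun (-1) n).
Proof.
move=> n5.
apply: (@herm_alt_set_bij R R^o _ _ (real_conj_algebra R) idfun (-1) n) => //.
- by move=> a b; exact: mulrC.
- by rewrite mulrNN mulr1.
- by move=> a b; exact: mulrC.
Qed.

Lemma SymC_bij n : ricci_bij (@gl_herm R (Rcomplex R) idfun 1 n).
Proof.
apply: (@herm_unit_set_bij R (Rcomplex R) _ _ (complex_conj_algebra R) idfun 1 n
  _ _ _ _ _ 1 1); rewrite ?mulr1 ?scale1r //.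
by move=> a b; exact: mulrC.
Qed.

Lemma AltC_bij n :
  (5 <= n)%N -> ricci_bij (@gl_herm R (Rcomplex R) idfun (-1) n).
Proof.
move=> n5.
apply: (@herm_alt_set_bij R (Rcomplex R) _ _ (complex_conj_algebra R)
  idfun (-1) n) => //.
- by move=> a b; exact: mulrC.
- by rewrite mulrNN mulr1.
- by move=> a b; exact: mulrC.
Qed.

Lemma HermC_bij n : ricci_bij (@gl_herm R (Rcomplex R) (@Rconjc R) 1 n).
Proof.
have cC := complex_conj_algebra R.
have c1 : Rconjc 1 = 1 :> Rcomplex R by congr Complex; rewrite /= oppr0.
by apply: (@herm_unit_set_bij R (Rcomplex R) _ _ cC (@Rconjc R) 1 n
  (conjM cC) (conjK cC) _ _ (re_conj cC) 1 1); rewrite ?mulr1 ?scale1r.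
Qed.

Lemma HermH_bij n : ricci_bij (@gl_herm R (quat R) (@conjq R) 1 n).
Proof.
have cH := quat_conj_algebra R.
have c1 : conjq 1 = 1 :> quat R by congr Quat; rewrite /= oppr0.
by apply: (@herm_unit_set_bij R (quat R) _ _ cH (@conjq R) 1 n
  (conjM cH) (conjK cH) _ _ (re_conj cH) 1 1); rewrite ?mulr1 ?scale1r.
Qed.

Lemma SkewH_bij n : ricci_bij (@gl_herm R (quat R) (@conjq R) (-1) n).
Proof.
have cH := quat_conj_algebra R.
apply: (@herm_unit_set_bij R (quat R) _ _ cH (@conjq R) (-1) n
  (conjM cH) (conjK cH) _ _ (re_conj cH)
  (Quat 0 1 0 0) (Quat 0 (-1) 0 0)) => //.
- by rewrite mulrNN mulr1.
all: by congr Quat => /=; ring.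
Qed.

Lemma TensC_bij m r : (2 <= m)%N -> (2 <= r)%N ->
  ricci_bij (@tensor_alg R (Rcomplex R) idfun m r
    setT (@sl (Rcomplex R) m) (@sl (Rcomplex R) r)).
Proof.
move=> m2 r2; have cC := complex_conj_algebra R.
have gP f : tensor_alg idfun setT (@sl (Rcomplex R) m) (@sl (Rcomplex R) r) f
    <-> exists AB, f = pair_act AB.
  apply: (@tensor_algP R (Rcomplex R) idfun idfun) => //; try exact: ltnW.
  by move=> a b; exact: mulrC.
by apply: (tensor_set_bij cC gP); apply: (tensor_prolong cC gP) => //;
  [exact: ltnW|left].
Qed.

Lemma TensR_bij m r : (2 <= m)%N -> (2 <= r)%N ->
  ricci_bij (@tensor_alg R R^o idfun m r setT (@sl R m) (@sl R r)).
Proof.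
move=> m2 r2; have cR := real_conj_algebra R.
have gP f : @tensor_alg R R^o idfun m r setT (@sl R m) (@sl R r) f
    <-> exists AB, f = pair_act AB.
  apply: (@tensor_algP R R^o idfun idfun) => //; try exact: ltnW.
  by move=> a b; exact: mulrC.
by apply: (tensor_set_bij cR gP); apply: (tensor_prolong cR gP) => //;
  [exact: ltnW|left].
Qed.

Lemma TensH_bij m r : (2 <= m)%N -> (1 <= r)%N ->
  ricci_bij (@tensor_alg R (quat R) (@conjq R) m r
    (range (fun a : R => a%:A)) (@slH R m) (@slH R r)).
Proof.
move=> m2 r1; have cH := quat_conj_algebra R.
have gP f : tensor_alg (@conjq R) (range (fun a : R => a%:A))
    (@slH R m) (@slH R r) f <-> exists AB, f = pair_act AB.
  apply: (@tensor_algP R (quat R) (@conjq R) (@qreal R)) => //.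
  - exact: ltnW.
  - exact: conjK cH.
  - by move=> [a b c d] [x y z t]; congr Quat => /=; ring.
  - by move=> [a b c d]; congr Quat => /=; ring.
  - by move=> A []; rewrite mulr1.
  - by move=> A []; rewrite mulr1.
apply: (tensor_set_bij cH gP); apply: (tensor_prolong cH gP) => //.
(* The commutator of i and j is 2k, which is invertible. *)
right; exists (Quat 0 1 0 0), (Quat 0 0 1 0) => -[a b c d] [] /= h1 h2 h3 h4.
by congr Quat; lra.
Qed.

End SplitCases.

Theorem theorem5p1 (R : realType) (V : vectType R) (g : set 'End(V))
    (hg : maximal_split g) :
  set_bij (im_antisym2 g) (ric_space g)
    (@ric R V : {linear tens2 V 'End(V) -> tens2 V R^o}).
Proof.
case: hg => [n _|n n5|n _|n n5|n _|n _|n _|m r mr|m r mr|m r mr].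
- exact: SymR_bij.
- exact: AltR_bij.
- exact: SymC_bij.
- exact: AltC_bij.
- exact: HermC_bij.
- exact: HermH_bij.
- exact: SkewH_bij.
- apply: TensC_bij; case: mr => -[rm r2] //.
  + by rewrite ltnW // (leq_trans _ rm).
  + by rewrite (leq_trans _ rm) // ltnW.
  + exact: ltnW.
- apply: TensR_bij; case: mr => -[rm r2] //.
  + by rewrite ltnW // (leq_trans _ rm).
  + by rewrite (leq_trans _ rm) // ltnW.
  + exact: ltnW.
- apply: TensH_bij; case: mr => -[rm r1] //.
  + by rewrite (leq_trans _ rm).
  + by rewrite (leq_trans r1).
  + exact: ltnW.
Qed.
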